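(* Let $n\ge 1$ and $f\in C_b^\infty(\mathbb{R}^n)$ (smooth, bounded, with all derivatives bounded). Define $u(t,x)=E_x[f(Z_t)]$ for $t\ge 0$, $x\in\mathbb{R}^n$, where $Z$ is $n$-dimensional iterated Brownian motion started at $x$. Then $u\in C^\infty((0,\infty)\times\mathbb{R}^n)\cap C_b([0,\infty)\times\mathbb{R}^n)$ and $u$ solves the Cauchy problem $$\Big(\tfrac18\Delta^2-\tfrac{\partial}{\partial t}\Big)u(t,x)=-\frac12\,\frac{1}{\sqrt{2\pi t}}\,\Delta f(x)\quad\text{on }(0,\infty)\times\mathbb{R}^n,\qquad u(0,x)=f(x),$$ where $\Delta$ is the Laplacian in $x$.
   Context: Let $X^+_t,X^-_t$ be independent $n$-dimensional Brownian motions started at $0$ and $Y_t$ an independent one-dimensional Brownian motion started at $0$. Two-sided Brownian motion is $X_t=X^+_t$ for $t\ge0$ and $X_t=X^-_{-t}$ for $t<0$. Iterated Brownian motion started at $z\in\mathbb{R}^n$ is $Z_t=z+X(Y_t)$, $t\ge0$; $P_z,E_z$ denote probability and expectation for $Z_0=z$. *)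

(* Defs.v *)
From HB Require Import structures.
From mathcomp Require Import all_boot all_order all_algebra.
From mathcomp Require Import all_classical all_reals all_analysis.
Set Implicit Arguments.
Unset Strict Implicit.
Unset Printing Implicit Defensive.
Import Order.TTheory GRing.Theory Num.Def Num.Theory.
Import numFieldNormedType.Exports.
Local Open Scope classical_set_scope.
Local Open Scope ring_scope.

Definition mutually_independent {d} {T : measurableType d} {R : realType}
  (P : probability T R) {I : eqType} (F : I -> set (set T)) : Prop :=
  forall s : seq I, uniq s ->
  forall A : I -> set T, (forall i, i \in s -> F i (A i)) ->
  P (\bigcap_(i in [set` s]) A i) = (\prod_(i <- s) P (A i))%E.

Definition sigma_gen {d} {T : measurableType d} {R : realType} {J : Type}
  (D : set J) (X : J -> T -> R) : set (set T) :=
  <<s \bigcup_(j in D) preimage_set_system setT (X j) measurable >>.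

Definition is_BM {d} {T : measurableType d} {R : realType}
  (P : probability T R) (B : R -> T -> R) : Prop :=
  [/\ (forall w, B 0 w = 0),
      (forall w, {within [set t : R | 0 <= t], continuous (B ^~ w)}),
      (forall t, 0 <= t -> measurable_fun setT (B t)),
      (forall s t, 0 <= s -> s < t -> forall A : set R, measurable A ->
          P ((fun w => B t w - B s w) @^-1` A) = normal_prob 0 (Num.sqrt (t - s)) A) &
      (forall (k : nat) (ts : nat -> R), 0 <= ts 0%N ->
          (forall i, (i < k)%N -> ts i < ts i.+1) ->
          mutually_independent P (fun i : 'I_k =>
             sigma_gen [set tt] (fun _ : unit => fun w => B (ts i.+1) w - B (ts i) w)))].

Definition ibm_proc {T : Type} {R : realType} {n : nat}
  (Xp Xm : 'I_n -> R -> T -> R) (Y : R -> T -> R)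
  (c : ('I_n + 'I_n + unit)%type) : R -> T -> R :=
  match c with
  | inl (inl i) => Xp i
  | inl (inr i) => Xm i
  | inr _ => Y
  end.

(** X^+, X^- independent n-dimensional Brownian motions (each an n-vector of
    independent 1-d standard BMs), Y an independent 1-d BM: all 2n+1 coordinate
    processes are standard BMs and the processes are mutually independent. *)
Definition iterated_BM_model {d} {T : measurableType d} {R : realType} {n : nat}
  (P : probability T R) (Xp Xm : 'I_n -> R -> T -> R) (Y : R -> T -> R) : Prop :=
  (forall c, is_BM P (ibm_proc Xp Xm Y c)) /\
  mutually_independent P (fun c => sigma_gen [set t : R | 0 <= t] (ibm_proc Xp Xm Y c)).

Definition two_sided_BM {T : Type} {R : realType} {n : nat}
  (Xp Xm : 'I_n -> R -> T -> R) (i : 'I_n) (s : R) (w : T) : R :=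
  if 0 <= s then Xp i s w else Xm i (- s) w.

Definition IBM {T : Type} {R : realType} {n : nat}
  (Xp Xm : 'I_n -> R -> T -> R) (Y : R -> T -> R) (z : 'rV[R]_n) (t : R) (w : T)
  : 'rV[R]_n :=
  \row_i (z 0 i + two_sided_BM Xp Xm i (Y t w) w).

Definition ibm_u {d} {T : measurableType d} {R : realType} {n : nat}
  (P : probability T R) (Xp Xm : 'I_n -> R -> T -> R) (Y : R -> T -> R)
  (f : 'rV[R]_n -> R) (p : R * 'rV[R]_n) : R :=
  fine ('E_P[fun w => f (IBM Xp Xm Y p.2 p.1 w)])%E.

Fixpoint iter_dderiv {R : numFieldType} {V W : normedModType R}
  (f : V -> W) (vs : seq V) : V -> W :=
  match vs with
  | [::] => f
  | v :: vs' => iter_dderiv ('D_v f) vs'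
  end.

Definition smooth_on {R : numFieldType} {V W : normedModType R}
  (D : set V) (f : V -> W) : Prop :=
  forall vs : seq V,
    (forall a, D a -> {for a, continuous (iter_dderiv f vs)}) /\
    (forall a v, D a -> derivable (iter_dderiv f vs) a v).

Definition Cb_infty {R : realType} {n : nat} (f : 'rV[R]_n -> R) : Prop :=
  smooth_on setT f /\
  forall vs : seq 'rV[R]_n, exists M : R, forall x, `|iter_dderiv f vs x| <= M.

Definition laplacian {R : realType} {n : nat} (f : 'rV[R]_n -> R) (x : 'rV[R]_n) : R :=
  \sum_(i < n) 'D_(delta_mx 0 i) ('D_(delta_mx 0 i) f) x.

Definition laplacian_x {R : realType} {n : nat} (g : R * 'rV[R]_n -> R)
  (p : R * 'rV[R]_n) : R :=
  \sum_(i < n) 'D_((0 : R, delta_mx 0 i)) ('D_((0 : R, delta_mx 0 i)) g) p.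

Definition deriv_t {R : realType} {n : nat} (g : R * 'rV[R]_n -> R)
  (p : R * 'rV[R]_n) : R :=
  'D_((1 : R, 0 : 'rV[R]_n)) g p.

(* Main.v *)
(** Let [G] be a standard Gaussian vector and [y] a standard Gaussian variable,
    independent of it.  Conditioning on the inner motion [Y t] (which is
    independent of the outer one) and Brownian scaling give
    [u (t, x) = E (heat f (sqrt t * |y|) x)] with
    [heat f s x = E (f (x + sqrt s *: G))].  No regularity of the transition
    density is needed: all derivatives fall on [f].  Gaussian integration by
    parts in each coordinate of [G] yields [d/ds heat f = heat (Laplacian f) / 2].
    Put [mixture k g (t, x) = E (|y| ^ k * heat g (sqrt t * |y|) x)]; its space
    derivatives fall on [g], and its time derivative is
    [mixture (k + 1) (Laplacian g) / (4 * sqrt t)].  Hence the combinations of the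
    [(sqrt t)^-j * mixture k g] are stable under differentiation, which gives
    smoothness.  For the equation, integrate [mixture 1 (Laplacian f)] by parts on
    each half-line in [y]: the interior terms give [1/8] of the bi-Laplacian and
    the boundary terms at [y = 0] give the right-hand side. *)

Require Import Defs.
From HB Require Import structures.
From mathcomp Require Import all_boot all_order all_algebra.
From mathcomp Require Import all_classical all_reals all_analysis.
From mathcomp Require Import measurable_realfun ring lra.
Set Implicit Arguments.
Unset Strict Implicit.
Unset Printing Implicit Defensive.
Import Order.TTheory GRing.Theory Num.Def Num.Theory.
Import numFieldNormedType.Exports.
Local Open Scope classical_set_scope.
Local Open Scope ring_scope.

(** * Limits and derivatives under the integral sign *)

(** The sample space is arbitrary and independence is given as product formulas for events.
    Conditioning is therefore done by discretization: a variable is replaced by finitely many grid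
    values, the product formula is applied cell by cell, and dominated convergence removes the grid.
    The same device compares the laws of two random vectors through boxes. The vector [G] is [X^+]
    at time 1 on the given space; it enters [heat] only through an expectation, so its dependence on
    the other processes is harmless. Smoothness is stated through iterated directional derivatives
    in space-time, so derivatives along arbitrary pairs (time, space) must exist; a general
    direction is split into its time and space parts, using continuity of the time derivative. The
    singularity of the square root confines differentiation to [t > 0], whereas continuity reaches
    [t = 0] by dominated convergence. In the integration by parts, [|y|] is written as [y] times its
    sign. The sign makes the integrand jump by [2 * g x] at [y = 0], and this jump is the source
    term. *)

(** A failure of continuity yields a violating point within [n.+1%:R^-1] of [p] for every [n]. This
    lets dominated convergence, a statement on sequences, give continuity in a parameter. *)
Lemma sequentially_continuous (R : realType) (V : pseudoMetricType R)
  (f : V -> R) (p : V) :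
  (forall u : nat -> V, u n @[n --> \oo] --> p -> f (u n) @[n --> \oo] --> f p) ->
  {for p, continuous f}.
Proof.
move=> H; apply/cvgrPdist_lt => e e0; apply: contrapT => Hn.
have /choice[u Hu] : forall n : nat, exists q : V,
    ball p n.+1%:R^-1 q /\ ~ (`|f p - f q| < e).
  move=> n; apply: contrapT => Hq; apply: Hn.
  have n0 : (0 : R) < n.+1%:R^-1 by rewrite invr_gt0.
  apply: filterS (nbhsx_ballx p _ n0) => q bq; apply: contrapT => nq.
  by apply: Hq; exists q.
have up : u n @[n --> \oo] --> p.
  apply/cvg_ballP => r r0; near=> n.
  have nr : n.+1%:R^-1 <= r.
    near: n; have /cvgrPdist_le/(_ _ r0) := @cvg_harmonic R.
    by apply: filterS => n; rewrite sub0r normrN ger0_norm ?invr_ge0.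
  by have [+ _] := Hu n; exact: le_ball nr _.
have /cvgrPdist_lt/(_ _ e0) := H u up.
by move=> [N _ /(_ N (leqnn _))]; have [_] := Hu N.
Unshelve. all: by end_near. Qed.

Section dominated_Rintegral.
Context d (T : measurableType d) (R : realType) (mu : {measure set T -> \bar R}).

Lemma le_Rintegrable (f g : T -> R) : measurable_fun setT f ->
  mu.-integrable setT (EFin \o g) -> (forall w, `|f w| <= g w) ->
  mu.-integrable setT (EFin \o f).
Proof.
move=> mf ig fg; apply: le_integrable ig => //.
  exact/measurable_EFinP.
by move=> w _ /=; rewrite lee_fin (le_trans (fg w))// ler_norm.
Qed.

Lemma measurable_fun_lim_pointwise (f_ : nat -> T -> R) (f : T -> R) :
  (forall n, measurable_fun setT (f_ n)) ->
  (forall w, f_ n w @[n --> \oo] --> f w) -> measurable_fun setT f.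
Proof.
move=> mf cf; apply: (measurable_realfun.measurable_fun_cvg mf) => w _; exact: cf.
Qed.

Lemma dominated_cvg_Rintegral (f_ : nat -> T -> R) (f g : T -> R) :
  (forall n, measurable_fun setT (f_ n)) ->
  (forall w, f_ n w @[n --> \oo] --> f w) ->
  mu.-integrable setT (EFin \o g) ->
  (forall n w, `|f_ n w| <= g w) ->
  \int[mu]_w f_ n w @[n --> \oo] --> \int[mu]_w f w.
Proof.
move=> mf cf ig fg.
have mf' : measurable_fun setT f := measurable_fun_lim_pointwise mf cf.
have fgl w : `|f w| <= g w.
  have cn : `|f_ n w| @[n --> \oo] --> `|f w| by apply: cvg_norm; exact: cf.
  rewrite -(cvg_lim _ cn)//; apply: limr_le; first by apply/cvg_ex; eexists; exact: cn.
  by apply: nearW => n; exact: fg.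
apply: fine_cvg; rewrite /Rintegral fineK; last first.
  apply: integrable_fin_num => //.
  exact: (le_Rintegrable mf' ig).
apply: (@dominated_cvg _ _ _ mu setT _ (fun n w => (f_ n w)%:E) _ (EFin \o g)) => //.
- by move=> n; exact/measurable_EFinP.
- move=> w _; apply: cvg_EFin; last exact: cf.
  exact: nearW.
- by move=> n w _ /=; rewrite lee_fin.
Qed.

Lemma continuous_Rintegral (V : pseudoMetricType R) (F : V -> T -> R)
  (g : T -> R) (p : V) :
  (forall q, measurable_fun setT (F q)) ->
  mu.-integrable setT (EFin \o g) ->
  (forall q w, `|F q w| <= g w) ->
  (forall w, {for p, continuous (F ^~ w)}) ->
  {for p, continuous (fun q => \int[mu]_w F q w)}.
Proof.
move=> mF ig Fg cF; apply: sequentially_continuous => u up.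
apply: (@dominated_cvg_Rintegral (fun n w => F (u n) w) _ g) => //.
by move=> w; apply: (cvg_comp u (F ^~ w) up); exact: cF.
Qed.

End dominated_Rintegral.

(** * Directional derivatives in a normed space *)

Section directional.
Context (R : realType) (V : normedModType R).
Implicit Types (f : V -> R) (x v p : V).

(** The two difference quotients coincide. One-variable calculus (chain rule, mean value theorem)
    thereby applies to directional derivatives. *)
Lemma is_derive_line f x v (h df : R) :
  is_derive (h *: v + x) v f df <->
  is_derive h 1 (fun r : R => f (r *: v + x)) df.
Proof.
have E : (fun r : R => r^-1 *: (f (r *: v + (h *: v + x)) - f (h *: v + x)))
  = (fun r : R => r^-1 *: (f ((r *: (1 : R) + h) *: v + x) - f (h *: v + x))).
  by apply/funext => r; rewrite addrA -scalerDl /GRing.scale/= mulr1.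
split=> -[] Hd Hv; apply: DeriveDef.
- by move: Hd; rewrite /derivable E.
- by move: Hv; rewrite /derive E.
- by move: Hd; rewrite /derivable -E.
- by move: Hv; rewrite /derive -E.
Qed.

Lemma is_derive_line0 f x v (df : R) :
  is_derive x v f df <-> is_derive (0 : R) 1 (fun r : R => f (r *: v + x)) df.
Proof. by rewrite -is_derive_line scale0r add0r. Qed.

Lemma is_derive_scaler f x v (c df : R) :
  is_derive x v f df -> is_derive x (c *: v) f (c * df).
Proof.
move=> /is_derive_line0 H; apply/is_derive_line0.
have -> : (fun r : R => f (r *: (c *: v) + x))
    = (fun r : R => f (r *: v + x)) \o (fun r => r * c).
  by apply/funext => r /=; rewrite scalerA.
rewrite mulrC; apply: is_derive1_comp; first by rewrite mul0r.
have := @is_deriveM R R id (cst c) 0 1 1 0 _ _.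
by rewrite scaler0 add0r /GRing.scale/= mulr1; exact.
Qed.

Lemma mean_value_line f f' x v (h : R) :
  (forall r : R, `|r| <= `|h| -> is_derive (r *: v + x) v f (f' (r *: v + x))) ->
  exists2 c : R, `|c| <= `|h| & f (h *: v + x) - f x = h * f' (c *: v + x).
Proof.
move=> H; pose g r := f (r *: v + x); pose g' r := f' (r *: v + x).
have dg (r : R) : `|r| <= `|h| -> is_derive r 1 g (g' r).
  by move=> /H; rewrite is_derive_line.
have cg (a b : R) : (forall r, r \in `[a, b] -> `|r| <= `|h|) ->
    {within `[a, b], continuous g}.
  move=> ab; apply: derivable_within_continuous => r rab.
  by have [] := dg r (ab r rab).
have g0 : g 0 = f x by rewrite /g scale0r add0r.
have [h0|/ltW h0] := leP 0 h.
- have I r : r \in `[0, h] -> `|r| <= `|h|.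
    by rewrite in_itv/= => /andP[r0 rh]; rewrite !ger0_norm.
  have [|c cI] := @MVT_segment _ g g' 0 h h0 _ (cg _ _ I).
    by move=> r /subset_itv_oo_cc rI; exact/dg/I.
  by rewrite g0 subr0 mulrC => E; exists c => //; exact: I.
- have I r : r \in `[h, 0] -> `|r| <= `|h|.
    by rewrite in_itv/= => /andP[r0 rh]; rewrite !ler0_norm// lerN2.
  have [|c cI] := @MVT_segment _ g g' h 0 h0 _ (cg _ _ I).
    by move=> r /subset_itv_oo_cc rI; exact/dg/I.
  rewrite g0 sub0r => E; exists c; first exact: I.
  by rewrite -opprB E mulrN opprK mulrC.
Qed.

(* Only the derivative along [a] is assumed continuous: the increment along
   [a + b] is split at [h *: b + p] and the mean value theorem is applied to
   the part along [a]. *)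
Lemma is_deriveDv f (f' : V -> R) (a b p : V) (l : R) :
  (\forall q \near p, is_derive q a f (f' q)) -> {for p, continuous f'} ->
  is_derive p b f l -> is_derive p (a + b) f (f' p + l).
Proof.
move=> na cf' [db Eb].
suff H : h^-1 *: (f (h *: (a + b) + p) - f p) @[h --> 0^'] --> f' p + l.
  by apply: DeriveDef; [apply/cvg_ex; exists (f' p + l)|exact/cvg_lim].
have Hb : h^-1 *: (f (h *: b + p) - f p) @[h --> 0^'] --> l.
  by rewrite -Eb; exact: db.
have -> : (fun h : R => h^-1 *: (f (h *: (a + b) + p) - f p)) =
    (fun h => h^-1 *: (f (h *: a + (h *: b + p)) - f (h *: b + p)))
    \+ (fun h => h^-1 *: (f (h *: b + p) - f p)).
  by apply/funext => h /=; rewrite -scalerDr addrA subrK addrA -scalerDr.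
apply: cvgD => //; apply/cvgrPdist_le => e e0.
have /cvgrPdist_le/(_ _ e0) := cf'; move: na => /filterI /[apply].
move=> /nbhs_normP[r /= r0 Hr].
(* If [|h| < r / m] and [|c| <= |h|], the point [c *: a + (h *: b + p)] stays within [r] of [p]. The
   summand 1 keeps [m] positive when [a] and [b] vanish. *)
pose m := `|a| + `|b| + 1.
have m0 : 0 < m by rewrite ltr_wpDl// addr_ge0.
near=> h.
have h0 : h != 0 by near: h; exact: nbhs_dnbhs_neq.
have hr : `|h| < r / m.
  near: h; apply: dnbhs0_lt; exact: divr_gt0.
have I c : `|c| <= `|h| -> ball_ [eta normr] p r (c *: a + (h *: b + p)).
  move=> ch; rewrite /= addrA opprD addrCA subrr addr0 normrN.
  apply: (le_lt_trans (ler_normD _ _)); rewrite !normrZ.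
  rewrite (@le_lt_trans _ _ (`|h| * m))// -?ltr_pdivlMr//.
  rewrite /m !mulrDr mulr1 -[leLHS]addr0 lerD// lerD2r.
  by rewrite ler_wpM2r.
have [c ch ->] := @mean_value_line f f' (h *: b + p) a h
  (fun c ch => (Hr _ (I c ch)).1).
rewrite /GRing.scale/= mulrA mulVf// mul1r.
exact: (Hr _ (I c ch)).2.
Unshelve. all: by end_near. Qed.

End directional.

(** The coordinate directions are added one at a time with [is_deriveDv]; continuity of the
    derivatives is what makes the derivative additive in its direction. *)
Lemma derive_row (R : realType) (n : nat) (f : 'rV[R]_n -> R) x v :
  (forall v y, derivable f y v) -> (forall v, continuous ('D_v f)) ->
  'D_v f x = \sum_(i < n) v 0 i * 'D_(delta_mx 0 i) f x.
Proof.
move=> df cf.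
suff [_ <-] : is_derive x (\sum_(i < n) v 0 i *: delta_mx 0 i) f
    (\sum_(i < n) v 0 i * 'D_(delta_mx 0 i) f x) by rewrite -row_sum_delta.
elim/big_rec2: _ => [|i y w _ IH]; first exact: is_derive0.
have Hi q : is_derive q (v 0 i *: delta_mx 0 i) f
  ('D_(v 0 i *: delta_mx 0 i) f q) by exact: derivableP.
have -> : v 0 i * 'D_(delta_mx 0 i) f x = 'D_(v 0 i *: delta_mx 0 i) f x.
  by have [_ ->] := is_derive_scaler (v 0 i) (derivableP (df (delta_mx 0 i) x)).
apply: (is_deriveDv (f' := 'D_(v 0 i *: delta_mx 0 i) f)) => //.
- by near=> q.
- exact: cf.
Unshelve. all: by end_near. Qed.

Section derive_Rintegral.
Context d (T : measurableType d) (R : realType) (mu : {measure set T -> \bar R}).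

(** Restricting to the line through [p] reduces this to one real parameter. The hypotheses bear only
    on a segment of radius [e], which can be chosen to keep the time away from 0. *)
Lemma is_derive_Rintegral (V : normedModType R) (F F' : V -> T -> R)
  (G : T -> R) (p v : V) (e : R) : 0 < e ->
  (forall h : R, `|h| < e -> mu.-integrable setT (EFin \o F (h *: v + p))) ->
  (forall (h : R) w, `|h| < e ->
     is_derive (h *: v + p) v (F ^~ w) (F' (h *: v + p) w)) ->
  mu.-integrable setT (EFin \o G) ->
  (forall (h : R) w, `|h| < e -> `|F' (h *: v + p) w| <= G w) ->
  is_derive p v (fun q => \int[mu]_w F q w) (\int[mu]_w F' p w).
Proof.
move=> e0 iF dF iG FG; apply/is_derive_line0.
pose f (r : R) w := F (r *: v + p) w.
have I0 : [set` `](-e), e[] (0 : R) by rewrite /= in_itv/= oppr_lt0 e0.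
have Ie x : [set` `](-e), e[] x -> `|x| < e.
  by rewrite /= in_itv/= ltr_norml.
have D x w : [set` `](-e), e[] x -> is_derive x 1 (f ^~ w) (F' (x *: v + p) w).
  by move=> /Ie xe; apply/(is_derive_line (F ^~ w)); exact: dF.
have D1 x w : [set` `](-e), e[] x -> (partial1of2 f) x w = F' (x *: v + p) w.
  by move=> /D H; rewrite partial1of2E; have [_ ->] := H w.
have G0 w : 0 <= G w by rewrite (le_trans _ (FG 0 w _)) ?normr0.
have intf x : [set` `](-e), e[] x -> mu.-integrable setT (EFin \o f x).
  by move=> /Ie; exact: iF.
have der x w : [set` `](-e), e[] x -> setT w -> derivable (f ^~ w) x 1.
  by move=> xe _; have [] := D x w xe.
have Gub x w : [set` `](-e), e[] x -> setT w -> `|partial1of2 f x w| <= G w.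
  by move=> xe _; rewrite D1//; apply: FG; exact: Ie.
have A := @derivable_under_integral R _ _ mu f setT measurableT 0 (-e) e
  I0 intf der G G0 iG Gub.
have B := @differentiation_under_integral R _ _ mu f setT measurableT 0 (-e) e
  I0 intf der G G0 iG Gub.
apply: DeriveDef; first exact: A.
rewrite -derive1E B; apply: eq_Rintegral => w _.
by rewrite D1// scale0r add0r.
Qed.

End derive_Rintegral.

(** * Expectations of independent variables *)

Section quantization.
Context (R : realType).
Implicit Types (y : R) (m : nat).

(** The number of cells of width [1 / (m + 1)] in an interval of length [2 * (m + 1)]. *)
Definition qsize m : nat := (2 * m.+1 ^ 2)%N.

(** A finite index type turns expectations into finite sums. By [truncn_cell] the index is in range,
    so [inord] never returns its default. *)
Definition cell m y : option 'I_(qsize m).+1 :=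
  if `|y| < m.+1%:R then Some (inord (Num.truncn ((y + m.+1%:R) * m.+1%:R)))
  else None.

(** Inside the range this is the left end of the cell. The value 0 at [None] keeps the approximation
    below [|y| + 1] in absolute value uniformly in [m], as dominated convergence requires. *)
Definition cellpt m (k : option 'I_(qsize m).+1) : R :=
  if k is Some j then j%:R / m.+1%:R - m.+1%:R else 0.

Definition quantize m y : R := cellpt (cell m y).

Lemma truncn_cell m y : `|y| < m.+1%:R ->
  let z := (y + m.+1%:R) * m.+1%:R in
  0 <= z /\ (Num.truncn z < (qsize m).+1)%N.
Proof.
rewrite ltr_norml => /andP[y1 y2] z.
have z0 : 0 <= z by rewrite mulr_ge0// -lerBlDr sub0r ltW.
have /andP[t1 t2] := truncn_itv z0.
have zN : z < (qsize m)%:R.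
  rewrite /qsize natrM natrX expr2 mulrA ltr_pM2r// mulrDl mul1r.
  by rewrite ltrD2r.
by split=> //; rewrite ltnS -(ler_nat R) (le_trans t1)// ltW.
Qed.

Lemma quantize_near m y : `|y| < m.+1%:R ->
  `|quantize m y - y| <= m.+1%:R^-1.
Proof.
move=> ym; have [z0 tN] := truncn_cell ym.
rewrite /quantize /cell ym /cellpt inordK//.
set z := (y + m.+1%:R) * m.+1%:R in z0 tN *.
have /andP[t1 t2] := truncn_itv z0.
have -> : (Num.truncn z)%:R / m.+1%:R - m.+1%:R - y =
   - ((z - (Num.truncn z)%:R) / m.+1%:R).
  have : m.+1%:R != 0 :> R by rewrite pnatr_eq0.
  by rewrite /z; move: m.+1%:R (Num.truncn _)%:R => c t c0; field.
rewrite normrN ger0_norm; last by rewrite divr_ge0// subr_ge0.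
rewrite ler_pdivrMr// mulVf ?pnatr_eq0// lerBlDl.
by rewrite -natr1 in t2; rewrite ltW.
Qed.

Lemma quantize_le m y : `|quantize m y| <= `|y| + 1.
Proof.
have [ym|ym] := ltP `|y| m.+1%:R; last first.
  by rewrite /quantize /cell ltNge ym/= normr0 addr_ge0.
rewrite -[X in `|X|](subrK y) addrC (le_trans (ler_normD _ _))// lerD2l.
by rewrite (le_trans (quantize_near ym))// invf_le1// ler1n.
Qed.

Lemma cvg_quantize y : quantize m y @[m --> \oo] --> y.
Proof.
apply/cvgrPdist_le => e e0; near=> m.
have ym : `|y| < m.+1%:R.
  rewrite (@lt_le_trans _ _ m%:R)// ?ler_nat//.
  by near: m; exact: nbhs_infty_gtr.
rewrite distrC (le_trans (quantize_near ym))//.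
near: m; have /cvgrPdist_le/(_ _ e0) := @cvg_harmonic R.
by apply: filterS => n; rewrite sub0r normrN ger0_norm ?invr_ge0.
Unshelve. all: by end_near. Qed.

Lemma measurable_cell m (k : option 'I_(qsize m).+1) :
  measurable [set y | cell m y = k].
Proof.
have mN : measurable [set y : R | `|y| < m.+1%:R].
  rewrite (_ : [set _ | _] = `]-m.+1%:R, m.+1%:R[%classic) ?measurable_itv//.
  by apply/seteqP; split=> y /=; rewrite in_itv/= ltr_norml.
case: k => [k|]; last first.
  rewrite (_ : [set _ | _] = ~` [set y : R | `|y| < m.+1%:R]).
    exact: measurableC.
  by apply/seteqP; split=> y /=; rewrite /cell; case: ifPn.
rewrite (_ : [set _ | _] = [set y : R | `|y| < m.+1%:R] `&`
   `[k%:R / m.+1%:R - m.+1%:R, k.+1%:R / m.+1%:R - m.+1%:R[%classic).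
  by apply: measurableI => //; exact: measurable_itv.
have E y : (y \in `[k%:R / m.+1%:R - m.+1%:R, k.+1%:R / m.+1%:R - m.+1%:R[) =
    (k%:R <= (y + m.+1%:R) * m.+1%:R < k.+1%:R).
  by rewrite in_itv/= lerBlDr ltrBrDr ler_pdivrMr// ltr_pdivlMr.
apply/seteqP; split=> y /=; rewrite /cell.
  case: ifPn => // ym [kE]; split=> //; rewrite E -kE.
  by have [z0 tN] := truncn_cell ym; rewrite inordK// truncn_itv.
move=> [ym]; rewrite E ym => H; congr Some.
by rewrite (truncn_def H); apply/val_inj => /=; rewrite inordK.
Qed.

End quantization.

Section quantized_vector.
Context d (T : measurableType d) (R : realType) (n : nat).
Implicit Types (V : 'I_n -> T -> R) (f : 'rV[R]_n -> R).

Definition vcell m V (w : T) : {ffun 'I_n -> option 'I_(qsize m).+1} :=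
  [ffun i => cell m (V i w)].

Definition vcellpt m (k : {ffun 'I_n -> option 'I_(qsize m).+1}) : 'rV[R]_n :=
  \row_i cellpt R (k i).

(** A vector cell is a box, the shape of event on which independence and equality of laws are
    known. *)
Lemma vcellE m V (k : {ffun 'I_n -> option 'I_(qsize m).+1}) :
  [set w | vcell m V w = k] =
  [set w | forall i, [set y : R | cell m y = k i] (V i w)].
Proof.
apply/seteqP; split=> w /= H; first by move=> i; rewrite -H ffunE.
by apply/ffunP => i; rewrite ffunE.
Qed.

Lemma measurable_box V (B : 'I_n -> set R) :
  (forall i, measurable_fun setT (V i)) -> (forall i, measurable (B i)) ->
  measurable [set w | forall i, B i (V i w)].
Proof.
move=> mV mB.
rewrite (_ : [set _ | _] = \bigcap_(i in setT) (V i @^-1` (B i))); last first.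
  by apply/seteqP; split=> w /= H i; [move=> _; exact: H|exact: (H i I)].
apply: fin_bigcap_measurable => // i _; rewrite -[X in measurable X]setTI.
exact: mV.
Qed.

Lemma measurable_vcell m V k : (forall i, measurable_fun setT (V i)) ->
  measurable [set w | vcell m V w = k].
Proof.
move=> mV; rewrite vcellE.
apply: (measurable_box (B := fun i => [set y | cell m y = k i])) => // i.
exact: measurable_cell.
Qed.

Lemma vcell_sum m V f w : f (vcellpt (vcell m V w)) =
  \sum_k f (vcellpt k) * \1_[set w' | vcell m V w' = k] w.
Proof.
rewrite (bigD1 (vcell m V w))//= indicE mem_set//= mulr1 big1 ?addr0// => k.
by move=> /eqP kw; rewrite indicE memNset ?mulr0//= => /esym.
Qed.

Lemma cvg_vcell V w : vcellpt (vcell m V w) @[m --> \oo] --> \row_i V i w.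
Proof.
have E (v : 'I_n -> R) : \row_i v i = \sum_(i < n) v i *: delta_mx 0 i.
  by rewrite [LHS]row_sum_delta; apply: eq_bigr => i _; rewrite mxE.
rewrite E.
have -> : (fun m => vcellpt (vcell m V w)) =
    (fun m => \sum_(i < n) quantize m (V i w) *: (delta_mx 0 i : 'rV[R]_n)).
  by apply/funext => m; rewrite /vcellpt E; apply: eq_bigr => i _; rewrite ffunE.
apply: cvg_big; first exact: add_continuous.
move=> i _; apply: cvgZr_tmp; exact: cvg_quantize.
Qed.

End quantized_vector.

Section Rintegral_sum.
Context d (T : measurableType d) (R : realType) (mu : {measure set T -> \bar R}).

Lemma integrable_sumr (I : Type) (s : seq I) (f : I -> T -> R) :
  (forall i, mu.-integrable setT (EFin \o f i)) ->
  mu.-integrable setT (EFin \o (fun w => \sum_(i <- s) f i w)).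
Proof.
move=> intf; elim: s => [|i s iS].
  rewrite [X in integrable _ _ X](_ : _ = cst 0%E); first exact: integrable0.
  by apply/funext => w /=; rewrite big_nil.
rewrite [X in integrable _ _ X](_ : _ =
  fun w => ((f i w)%:E + (\sum_(i <- s) f i w)%R%:E)%E).
  exact: (integrableD measurableT (intf i) iS).
by apply/funext => w /=; rewrite big_cons EFinD.
Qed.

Lemma Rintegral_sum (I : Type) (s : seq I) (f : I -> T -> R) :
  (forall i, mu.-integrable setT (EFin \o f i)) ->
  \int[mu]_w (\sum_(i <- s) f i w) = \sum_(i <- s) \int[mu]_w f i w.
Proof.
move=> intf; elim: s => [|i s IH].
  under eq_Rintegral do rewrite big_nil.
  by rewrite Rintegral_cst// mul0r big_nil.
under eq_Rintegral do rewrite big_cons.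
by rewrite RintegralD// ?IH ?big_cons//; exact: integrable_sumr.
Qed.

Lemma Rintegral_indic (A : set T) : measurable A ->
  \int[mu]_w \1_A w = fine (mu A).
Proof. by move=> mA; rewrite /Rintegral integral_indic// setIT. Qed.

End Rintegral_sum.

Section bounded_random_variables.
Context d (T : measurableType d) (R : realType) (P : probability T R).

Lemma integrable_bounded (f : T -> R) (M : R) : measurable_fun setT f ->
  (forall w, `|f w| <= M) -> P.-integrable setT (EFin \o f).
Proof.
move=> mf fM; apply: (le_Rintegrable (g := cst M) mf) => //.
exact: finite_measure_integrable_cst.
Qed.

Lemma integrable_indic_bounded (A : set T) : measurable A ->
  P.-integrable setT (EFin \o (\1_A : T -> R)).
Proof.
move=> mA; apply: (@integrable_bounded _ 1); first exact: measurable_indic.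
by move=> w; rewrite indicE ger0_norm// lern1; case: (_ \in _).
Qed.

Context (n : nat).
Implicit Types (V : 'I_n -> T -> R) (f : 'rV[R]_n -> R).

Lemma measurable_fun_vcell m V f : (forall i, measurable_fun setT (V i)) ->
  measurable_fun setT (fun w => f (vcellpt R (vcell m V w))).
Proof.
move=> mV; under eq_fun do rewrite vcell_sum.
apply: measurable_sum => k; apply: measurable_funM => //.
by apply: measurable_indic; exact: measurable_vcell.
Qed.

(** Measurability is available coordinate by coordinate; the composite inherits it as a pointwise
    limit of finite sums of indicators of boxes. *)
Lemma measurable_fun_row V f : (forall i, measurable_fun setT (V i)) ->
  continuous f -> measurable_fun setT (fun w => f (\row_i V i w)).
Proof.
move=> mV cf.
apply: (measurable_fun_lim_pointwise (fun m => measurable_fun_vcell m f mV)).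
by move=> w; apply: continuous_cvg; [exact: cf|exact: cvg_vcell].
Qed.

Lemma Rintegral_vcell m (A : set T) V f : measurable A ->
  (forall i, measurable_fun setT (V i)) ->
  \int[P]_w (\1_A w * f (vcellpt R (vcell m V w))) =
  \sum_k f (vcellpt R k) * fine (P (A `&` [set w | vcell m V w = k])).
Proof.
move=> mA mV; have mk (k : {ffun 'I_n -> option 'I_(qsize m).+1}) := measurable_vcell k mV.
under eq_Rintegral.
  move=> w _; rewrite vcell_sum mulr_sumr; under eq_bigr do
    rewrite mulrCA -[_ * \1__ w]/((\1_A \* \1__) w) -indicI. over.
rewrite Rintegral_sum.
  apply: eq_bigr => k _; rewrite RintegralZl ?Rintegral_indic//.
  - exact: measurableI.
  - by apply: integrable_indic_bounded; exact: measurableI.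
move=> k; apply: (@integrable_bounded _ `|f (vcellpt R k)|).
  apply: measurable_funM => //.
  by apply: measurable_indic; exact: measurableI.
move=> w; rewrite normrM ler_piMr// indicE ger0_norm// lern1.
by case: (_ \in _).
Qed.

Lemma cvg_Rintegral_vcell (A : set T) V f (M : R) : measurable A ->
  (forall i, measurable_fun setT (V i)) ->
  continuous f -> (forall x, `|f x| <= M) ->
  \int[P]_w (\1_A w * f (vcellpt R (vcell m V w))) @[m --> \oo] -->
  \int[P]_w (\1_A w * f (\row_i V i w)).
Proof.
move=> mA mV cf fM.
apply: (@dominated_cvg_Rintegral _ _ _ _ _ _ (cst M)).
- move=> m; apply: measurable_funM; first exact: measurable_indic.
  exact: measurable_fun_vcell.
- move=> w; apply: cvgZl_tmp.
  by apply: continuous_cvg; [exact: cf|exact: cvg_vcell].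
- exact: finite_measure_integrable_cst.
- move=> m w /=; rewrite normrM (le_trans _ (fM (vcellpt R (vcell m V w))))//.
  by rewrite ler_piMl// indicE ger0_norm// lern1; case: (_ \in _).
Qed.

(* Taking [A1 = A2 = setT] and [c1 = c2 = 1] compares the laws of two random
   vectors; taking [c1 = 1] and [A2 = setT] factorizes an expectation. *)
Lemma Rintegral_eq_boxes (c1 c2 : R) (A1 A2 : set T) V1 V2 f (M : R) :
  measurable A1 -> measurable A2 ->
  (forall i, measurable_fun setT (V1 i)) ->
  (forall i, measurable_fun setT (V2 i)) ->
  (forall B : 'I_n -> set R, (forall i, measurable (B i)) ->
    c1 * fine (P (A1 `&` [set w | forall i, B i (V1 i w)])) =
    c2 * fine (P (A2 `&` [set w | forall i, B i (V2 i w)]))) ->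
  continuous f -> (forall x, `|f x| <= M) ->
  c1 * \int[P]_w (\1_A1 w * f (\row_i V1 i w)) =
  c2 * \int[P]_w (\1_A2 w * f (\row_i V2 i w)).
Proof.
move=> mA1 mA2 mV1 mV2 H cf fM.
have L c A V (mA : measurable A) (mV : forall i, measurable_fun setT (V i)) :
    c * \int[P]_w (\1_A w * f (vcellpt R (vcell m V w))) @[m --> \oo] -->
    c * \int[P]_w (\1_A w * f (\row_i V i w)).
  apply: cvgMr; exact: cvg_Rintegral_vcell fM.
apply: (cvg_unique _ (L c1 A1 V1 mA1 mV1)) => //.
suff -> : (fun m => c1 * \int[P]_w (\1_A1 w * f (vcellpt R (vcell m V1 w)))) =
  (fun m => c2 * \int[P]_w (\1_A2 w * f (vcellpt R (vcell m V2 w)))) by exact: L.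
apply/funext => m; rewrite !Rintegral_vcell// !mulr_sumr.
apply: eq_bigr => k _; rewrite !vcellE mulrCA [RHS]mulrCA; congr (_ * _).
apply: (H (fun i => [set y | cell m y = k i])) => i; exact: measurable_cell.
Qed.

End bounded_random_variables.

(** * Integrating out an independent variable *)

Section freezing.
Context d (T : measurableType d) (R : realType) (P : probability T R).

Lemma cell_sum (F : R -> T -> R) (Y : T -> R) m w :
  F (quantize m (Y w)) w =
  \sum_k F (cellpt R k) w * \1_[set w' | cell m (Y w') = k] w.
Proof.
rewrite (bigD1 (cell m (Y w)))//= indicE mem_set//= mulr1 big1 ?addr0// => k.
by move=> /eqP kw; rewrite indicE memNset ?mulr0//= => /esym.
Qed.

(* The factorization hypothesis says that [Y] is independent of the family
   [F], which may therefore be integrated first. *)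
Lemma freezing (F : R -> T -> R) (Y : T -> R) (M : R) :
  measurable_fun setT Y -> P.-integrable setT (EFin \o Y) ->
  (forall w, continuous (F ^~ w)) -> (forall y, measurable_fun setT (F y)) ->
  (forall y w, `|F y w| <= M * (`|y| + 1)) ->
  (forall y (B : set R), measurable B ->
    \int[P]_w (\1_(Y @^-1` B) w * F y w) =
    fine (P (Y @^-1` B)) * \int[P]_w F y w) ->
  \int[P]_w F (Y w) w = \int[P]_w (\int[P]_w' F (Y w) w').
Proof.
move=> mY iY cF mF FM indep.
pose H y := \int[P]_w F y w.
have M0 : 0 <= M.
  have /(_ (point : T)) := FM 0; rewrite normr0 add0r mulr1.
  exact: le_trans.
have mYB (B : set R) : measurable B -> measurable (Y @^-1` B).
  by move=> mB; rewrite -[X in measurable X]setTI; exact: mY.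
have mc m (k : option 'I_(qsize m).+1) :
    measurable [set w | cell m (Y w) = k] by exact: (mYB _ (measurable_cell k)).
have ind1 (A : set T) w : `|\1_A w : R| <= 1.
  by rewrite indicE ger0_norm// lern1; case: (_ \in _).
have intF y : P.-integrable setT (EFin \o F y).
  exact: integrable_bounded (mF y) (FM y).
have intFk m (k : option 'I_(qsize m).+1) y : P.-integrable setT
   (EFin \o (fun w => F y w * \1_[set w' | cell m (Y w') = k] w)).
  apply: (@integrable_bounded _ _ _ _ _ (M * (`|y| + 1))).
    by apply: measurable_funM; [by apply: mF || exact: measurable_cst|apply: measurable_indic; exact: mc].
  by move=> w; rewrite normrM (le_trans _ (FM y w))// ler_piMr.
have qle m y w : `|F (quantize m y) w| <= M * (`|y| + 2).
  rewrite (le_trans (FM _ _))// ler_wpM2l// -[2]/(1 + 1) addrA lerD2r.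
  exact: quantize_le.
have qH m y : `|H (quantize m y)| <= M * (`|y| + 2).
  rewrite (le_trans (le_normr_Rintegral _ (intF _)))//.
  rewrite [leRHS](_ : _ = \int[P]_w cst (M * (`|y| + 2)) w); last first.
    by rewrite Rintegral_cst// [X in fine X](@probability_setT _ _ _ P) mulr1.
  apply: le_Rintegral => [//|||w _]; last exact: qle.
    exact: (integrable_norm (intF (quantize m y))).
  exact: finite_measure_integrable_cst.
have cqF y w : F (quantize m y) w @[m --> \oo] --> F y w.
  exact: (cvg_comp _ (F ^~ w) (@cvg_quantize R y) (@cF w y)).
have mFq m : measurable_fun setT (fun w => F (quantize m (Y w)) w).
  under eq_fun do rewrite cell_sum.
  apply: measurable_sum => k; apply: measurable_funM; first (by apply: mF || exact: measurable_cst).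
  by apply: measurable_indic; exact: mc.
have mHq m : measurable_fun setT (fun w => H (quantize m (Y w))).
  under eq_fun do rewrite (cell_sum (fun y _ => H y)).
  apply: measurable_sum => k; apply: measurable_funM; first (by apply: mF || exact: measurable_cst).
  by apply: measurable_indic; exact: mc.
have ig : P.-integrable setT (EFin \o (fun w => M * (`|Y w| + 2))).
  rewrite [X in integrable _ _ X](_ : _ =
    fun w => (M%:E * (`|Y w|%:E + cst 2%:E w))%E)//.
  apply: integrableZl => //.
  apply: (integrableD measurableT (integrable_norm iY)).
  exact: finite_measure_integrable_cst.
have L1 : \int[P]_w F (quantize m (Y w)) w @[m --> \oo] --> \int[P]_w F (Y w) w.
  by apply: (dominated_cvg_Rintegral mFq _ ig) => // w; exact: cqF.
(* Two nested dominated convergences: the inner one, with [Y w] fixed, gives the convergence of [H]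
   along the grid, and the outer one integrates it. *)
have L2 : \int[P]_w H (quantize m (Y w)) @[m --> \oo] --> \int[P]_w H (Y w).
  apply: (dominated_cvg_Rintegral mHq _ ig) => // w.
  apply: (@dominated_cvg_Rintegral _ _ _ _ _ _ (cst (M * (`|Y w| + 2)))).
  - by move=> m; exact: mF.
  - by move=> w'; exact: cqF.
  - exact: finite_measure_integrable_cst.
  - by move=> m w' /=; exact: qle.
apply: (cvg_unique _ L1) => //.
(* For the quantized [Y] both sides are finite sums over cells, and the factorization hypothesis
   identifies them term by term. *)
suff -> : (fun m => \int[P]_w F (quantize m (Y w)) w) =
  (fun m => \int[P]_w H (quantize m (Y w))) by [].
apply/funext => m.
under eq_Rintegral do rewrite cell_sum.
under [RHS]eq_Rintegral do rewrite (cell_sum (fun y _ => H y)).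
rewrite !Rintegral_sum; last 2 first.
- move=> k; apply: (@integrable_bounded _ _ _ _ _ `|H (cellpt R k)|).
    by apply: measurable_funM; [by apply: mF || exact: measurable_cst|apply: measurable_indic; exact: mc].
  by move=> w; rewrite normrM ler_piMr.
- by move=> k; exact: intFk.
apply: eq_bigr => k _.
rewrite RintegralZl ?Rintegral_indic//; last exact: integrable_indic_bounded.
rewrite mulrC -(indep (cellpt R k) [set y | cell m y = k] (measurable_cell _)).
by apply: eq_Rintegral => w _; rewrite mulrC.
Qed.

End freezing.

(** * The Gaussian law *)

Section normal_density.
Context (R : realType).
Local Notation mu := (@lebesgue_measure R).

(** The derivative is an abstractly chosen function, identified with the density almost everywhere
    because both have the same integrals over measurable sets. *)
Lemma Radon_Nikodym_normal_prob (m s : R) :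
  ae_eq mu setT (Radon_Nikodym (charge_of_finite_measure (normal_prob m s)) mu)
    (EFin \o normal_pdf m s).
Proof.
rewrite Radon_NikodymE//=; first exact: normal_prob_dominates.
move=> dom; case: cid => /= h [h1 h2 h3].
apply: integral_ae_eq => //=.
  by apply/measurable_EFinP; exact: measurable_normal_pdf.
by move=> E _ mE; rewrite -h3.
Qed.

Lemma integral_normal_prob (m s : R) (H : R -> R) : measurable_fun setT H ->
  (normal_prob m s).-integrable setT (EFin \o H) ->
  (\int[normal_prob m s]_y (H y)%:E =
   \int[mu]_y ((H y)%:E * (normal_pdf m s y)%:E))%E.
Proof.
move=> mH iH.
have dom : charge_of_finite_measure (normal_prob m s) `<< mu.
  exact: normal_prob_dominates.
rewrite -(Radon_Nikodym_change_of_variables (normal_prob_dominates m s))//=.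
apply: ae_eq_integral => //.
- apply: emeasurable_funM; first exact/measurable_EFinP.
  exact: (measurable_int _ (Radon_Nikodym_integrable dom)).
- apply: emeasurable_funM; first exact/measurable_EFinP.
  by apply/measurable_EFinP; exact: measurable_normal_pdf.
- apply: ae_eqe_mul2l; exact: Radon_Nikodym_normal_prob.
Qed.

(** The truncations [min (H y) n] are bounded, hence integrable, and monotone convergence lifts the
    bound. The formula can thus serve to prove that a normal variable is integrable. *)
Lemma ge0_integral_normal_prob (m s : R) (H : R -> R) :
  measurable_fun setT H -> (forall y, 0 <= H y) ->
  (\int[normal_prob m s]_y (H y)%:E =
   \int[mu]_y ((H y)%:E * (normal_pdf m s y)%:E))%E.
Proof.
move=> mH H0.
pose h n y : R := Num.min (H y) n%:R.
have mh n : measurable_fun setT (h n) by exact: measurable_minr.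
have h0 n y : 0 <= h n y by rewrite le_min H0 ler0n.
have hE y : exists N, forall n, (N <= n)%N -> h n y = H y.
  exists (Num.truncn (H y)).+1 => n nN; apply/min_idPl.
  rewrite ltW// (lt_le_trans (truncnS_gt _))// ler_nat//.
have ndh y : {homo h^~ y : n k / (n <= k)%N >-> n <= k}.
  by move=> n k nk; rewrite le_min !ge_min lexx/= ler_nat nk orbT.
have L1 : (\int[normal_prob m s]_y (h n y)%:E @[n --> \oo] -->
    \int[normal_prob m s]_y (H y)%:E)%E.
  have -> : (\int[normal_prob m s]_y (H y)%:E =
      \int[normal_prob m s]_y (fun y => limn (fun n => (h n y)%:E)) y)%E.
    apply: eq_integral => y _; apply/esym/cvg_lim => //.
    have [N HN] := hE y; apply: cvg_near_cst.
    by exists N => // n /= nN; rewrite HN.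
  apply: cvg_monotone_convergence => [//|n|n y _|y _ n k nk].
  - by apply/measurable_EFinP; exact: mh.
  - by rewrite lee_fin; exact: h0.
  - by rewrite lee_fin; exact: ndh.
have L2 : (\int[mu]_y ((h n y)%:E * (normal_pdf m s y)%:E) @[n --> \oo] -->
    \int[mu]_y ((H y)%:E * (normal_pdf m s y)%:E))%E.
  have -> : (\int[mu]_y ((H y)%:E * (normal_pdf m s y)%:E) =
      \int[mu]_y (fun y => limn (fun n => (h n y)%:E * (normal_pdf m s y)%:E)) y)%E.
    apply: eq_integral => y _; apply/esym/cvg_lim => //.
    have [N HN] := hE y; apply: cvg_near_cst.
    by exists N => // n /= nN; rewrite HN.
  apply: cvg_monotone_convergence => [//|n|n y _|y _ n k nk].
  - apply: emeasurable_funM; first by apply/measurable_EFinP; exact: mh.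
    by apply/measurable_EFinP; exact: measurable_normal_pdf.
  - by rewrite -EFinM lee_fin mulr_ge0 ?h0 ?normal_pdf_ge0.
  - rewrite lee_wpmul2r// ?lee_fin ?normal_pdf_ge0//.
    exact: ndh.
apply: (cvg_unique _ L1) => //.
suff -> : (fun n => \int[normal_prob m s]_y (h n y)%:E)%E =
  (fun n => \int[mu]_y ((h n y)%:E * (normal_pdf m s y)%:E))%E by [].
apply/funext => n; apply: integral_normal_prob => //.
apply: (integrable_bounded _ (M := n%:R)) => [|y]; first exact: mh.
by rewrite ger0_norm ?h0// ge_min lexx orbT.
Qed.

Definition gdens (y : R) : R := normal_pdf 0 1 y.

Lemma gdensE y : gdens y = (Num.sqrt (2 * pi))^-1 * expR (- (y ^+ 2 / 2)).
Proof.
rewrite /gdens normal_pdfE ?oner_neq0// /normal_peak /normal_fun.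
by rewrite expr1n mul1r subr0 mulNr -[pi *+ 2]mulr_natl.
Qed.

Lemma gdens_ge0 y : 0 <= gdens y. Proof. exact: normal_pdf_ge0. Qed.

Lemma continuous_gdens : continuous gdens.
Proof. by apply: continuous_normal_pdf; exact: oner_neq0. Qed.

Lemma measurable_gdens : measurable_fun setT gdens.
Proof. exact: measurable_normal_pdf. Qed.

Lemma normal_pdf_scale (s y : R) : 0 < s ->
  normal_pdf 0 s (s * y) * s = gdens y.
Proof.
move=> s0; have sN0 : s != 0 by rewrite gt_eqF.
rewrite /gdens !normal_pdfE ?oner_neq0// /normal_fun !subr0 expr1n.
have -> : - (s * y) ^+ 2 / (s ^+ 2 *+ 2) = - y ^+ 2 / (1 *+ 2).
  by rewrite -(mulr_natl (s ^+ 2)) -(mulr_natl 1); field.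
rewrite mulrAC; congr (_ * _).
rewrite /normal_peak -!mulrnAr sqrtrM ?sqr_ge0// sqrtr_sqr (gtr0_norm s0).
by rewrite expr1n mul1r invfM mulrAC mulVf// mul1r.
Qed.

(** Since [|y| ^ k <= exp (k * |y|)] and [k * |y| - y^2 / 2 <= k^2 - y^2 / 4], which is the
    inequality [(|y| / 2 - k)^2 >= 0], the integrand is at most a constant times the normal density
    of variance 2. *)
Lemma integrable_moment (k : nat) :
  mu.-integrable setT (EFin \o (fun y => `|y| ^+ k * gdens y)).
Proof.
have s0 : Num.sqrt 2 != 0 :> R by rewrite sqrtr_eq0 -ltNge.
pose c : R := expR (k%:R ^+ 2) * (normal_peak 1 / normal_peak (Num.sqrt 2)).
apply: (@le_Rintegrable _ _ _ mu _ (fun y => c * normal_pdf 0 (Num.sqrt 2) y)).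
- apply: measurable_funM; last exact: measurable_gdens.
  by apply: measurable_funX; exact: normr_measurable.
- rewrite [X in integrable _ _ X](_ : _ =
    fun y => (c%:E * (normal_pdf 0 (Num.sqrt 2) y)%:E)%E)//.
  by apply: integrableZl => //; exact: integrable_normal_pdf.
- move=> y; rewrite normrM ger0_norm ?exprn_ge0// (ger0_norm (gdens_ge0 _)).
  rewrite /gdens !normal_pdfE// ?oner_neq0// /normal_fun expr1n subr0.
  have pb0 : normal_peak (Num.sqrt 2) != 0 :> R by rewrite gt_eqF ?normal_peak_gt0.
  rewrite /c; move: (normal_peak 1) (normal_peak_ge0 (1 : R)) => pa pa0.
  set e1 := expR (- y ^+ 2 / _); set e2 := expR (- y ^+ 2 / _).
  move: (normal_peak _) pb0 => pb pb0.
  rewrite mulrCA [leRHS](_ : _ = pa * (expR (k%:R ^+ 2) * e2)); last by field.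
  rewrite ler_wpM2l// {}/e1 {}/e2.
  rewrite sqr_sqrtr// -expRD.
  apply: (@le_trans _ _ (expR `|y| ^+ k * expR (- y ^+ 2 / (1 *+ 2)))).
    rewrite ler_wpM2r ?expR_ge0// lerXn2r ?nnegrE ?expR_ge0//.
    by rewrite (le_trans _ (expR_ge1Dx _))// lerDr.
  rewrite -expRM_natl -expRD ler_expR -[y ^+ 2]real_normK ?num_real//.
  set a := `|y|; set b : R := k%:R.
  have := sqr_ge0 (a / 2 - b); rewrite -mulr_natl; nra.
Qed.

End normal_density.

(** * Expectations of functions of a centred normal variable *)

Section law_of_normal.
Context d (T : measurableType d) (R : realType) (P : probability T R).
Local Notation mu := (@lebesgue_measure R).
Variables (Y : T -> R) (s : R).
Hypotheses (mY : measurable_fun setT Y) (s0 : 0 < s).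
Hypothesis lawY : forall A : set R, measurable A ->
  P (Y @^-1` A) = normal_prob 0 s A.

Lemma ge0_integral_normal_law (H : R -> R) : continuous H ->
  (forall y, 0 <= H y) ->
  (\int[P]_w (H (Y w))%:E = \int[mu]_y (H (s * y) * gdens y)%:E)%E.
Proof.
move=> cH H0.
have mH : measurable_fun setT H by exact: continuous_measurable_fun.
have mY' : measurable_fun (U := measurableTypeR R) setT Y by exact: mY.
pose Z : {RV P >-> measurableTypeR R} :=
  @mfun_Sub _ _ T (measurableTypeR R) Y (mem_set mY').
have -> : (\int[P]_w (H (Y w))%:E = \int[distribution P Z]_y (H y)%:E)%E.
  by rewrite ge0_integral_distribution//; exact/measurable_EFinP.
transitivity (\int[normal_prob 0 s]_y (H y)%:E)%E.
  by apply: eq_measure_integral => A mA _; exact: lawY.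
rewrite ge0_integral_normal_prob//.
have sN0 : s != 0 by rewrite gt_eqF.
have dF : (fun y : R => y * s)^`()%classic = cst s.
  apply/funext => y; rewrite derive1E deriveM// derive_cst derive_id scaler0.
  by rewrite add0r /GRing.scale/= mulr1.
transitivity (\int[mu]_y ((((fun y => H y * normal_pdf 0 s y)
    \o (fun y : R => y * s)) * (fun y : R => y * s)^`()%classic) y)%:E)%E.
  rewrite -increasing_ge0_integration_by_substitutionT.
  - by apply: eq_integral => y _; rewrite EFinM.
  - by move=> x y xy; rewrite ltr_pM2r.
  - by rewrite dF => ?; exact: cvg_cst.
  - by rewrite dF; exact: is_cvg_cst.
  - by rewrite dF; exact: is_cvg_cst.
  - by [].
  - exact: gt0_cvgMlNy.
  - exact: gt0_cvgMly.
  - move=> y; apply: cvgM; first exact: cH.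
    exact: continuous_normal_pdf.
  - by move=> y; rewrite mulr_ge0// normal_pdf_ge0.
apply: eq_integral => y _; rewrite dF /= !fctE /= -mulrA [y * s]mulrC.
by rewrite normal_pdf_scale.
Qed.

Lemma integrable_normal_law : P.-integrable setT (EFin \o Y).
Proof.
apply/integrableP; split; first exact/measurable_EFinP.
rewrite (_ : (fun w => _) = (fun w => (`|Y w|)%:E))//.
rewrite (@ge0_integral_normal_law (fun y => `|y|))//; last exact: norm_continuous.
have /integrableP[_] := integrableZl measurableT s (integrable_moment R 1).
apply: le_lt_trans; rewrite le_eqVlt; apply/orP; left; apply/eqP.
apply: eq_integral => y _; rewrite /= expr1; congr EFin.
by rewrite !normrM normr_id (ger0_norm (gdens_ge0 y)) mulrA.
Qed.

(** With [B] the affine bound on [|H|], both [B] and [B + H] are nonnegative and continuous. The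
    nonnegative formula holds for each, and the contribution of [B] cancels. *)
Lemma Rintegral_normal_law (H : R -> R) (M : R) : continuous H ->
  (forall y, `|H y| <= M * (`|y| + 1)) ->
  \int[P]_w H (Y w) = \int[mu]_y (H (s * y) * gdens y).
Proof.
move=> cH HM.
pose B (y : R) : R := M * (`|y| + 1).
have cB : continuous B.
  move=> y; apply: cvgM; first exact: cvg_cst.
  by apply: cvgD; [exact: norm_continuous|exact: cvg_cst].
have B0 y : 0 <= B y by rewrite (le_trans _ (HM y)).
have M0 : 0 <= M by have := B0 0; rewrite /B normr0 add0r mulr1.
have mB : measurable_fun setT B by exact: continuous_measurable_fun.
have mH : measurable_fun setT H by exact: continuous_measurable_fun.
have ge (F : R -> R) : continuous F -> (forall y, 0 <= F y) ->
    \int[P]_w F (Y w) = \int[mu]_y (F (s * y) * gdens y).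
  by move=> cF F0; rewrite /Rintegral ge0_integral_normal_law.
have iB : P.-integrable setT (EFin \o (fun w => B (Y w))).
  rewrite [X in integrable _ _ X](_ : _ =
    fun w => (M%:E * ((`|Y w|)%:E + cst 1%:E w))%E)//.
  apply: integrableZl => //.
  apply: (integrableD measurableT (integrable_norm integrable_normal_law)).
  exact: finite_measure_integrable_cst.
have iH : P.-integrable setT (EFin \o (fun w => H (Y w))).
  by apply: (le_Rintegrable _ iB) => //; exact: measurableT_comp.
have iB' : mu.-integrable setT (EFin \o (fun y => B (s * y) * gdens y)).
  rewrite [X in integrable _ _ X](_ : _ = fun y =>
    (M%:E * (s%:E * (`|y| ^+ 1 * gdens y)%:E + (`|y| ^+ 0 * gdens y)%:E))%E).
    apply: integrableZl => //; apply: integrableD => //; last first.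
      exact: integrable_moment.
    by apply: integrableZl => //; exact: integrable_moment.
  apply/funext => y.
  transitivity ((M * (s * (`|y| ^+ 1 * gdens y) + `|y| ^+ 0 * gdens y))%:E);
    last by [].
  by congr EFin; rewrite /B normrM (gtr0_norm s0) expr1 expr0; ring.
have mHs : measurable_fun setT (fun y => H (s * y)).
  by apply: measurableT_comp => //; exact: mulrl_measurable.
have iH' : mu.-integrable setT (EFin \o (fun y => H (s * y) * gdens y)).
  apply: (le_Rintegrable _ iB') => [|y].
    by apply: measurable_funM => //; exact: measurable_gdens.
  by rewrite normrM (ger0_norm (gdens_ge0 y)) ler_wpM2r ?gdens_ge0.
have cBH : continuous (fun y => B y + H y).
  by move=> y; apply: cvgD; [exact: cB|exact: cH].
have BH0 y : 0 <= B y + H y.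
  by have := HM y; rewrite ler_norml -lerBlDl sub0r => /andP[].
have := ge _ cBH BH0; rewrite RintegralD// (ge B)//.
have -> : \int[mu]_y ((B (s * y) + H (s * y)) * gdens y) =
    \int[mu]_y (B (s * y) * gdens y) + \int[mu]_y (H (s * y) * gdens y).
  by rewrite -RintegralD//; apply: eq_Rintegral => y _; rewrite mulrDl.
exact: addrI.
Qed.

End law_of_normal.

Section normal_scaling.
Context (R : realType).
Local Notation mu := (@lebesgue_measure R).

Lemma normal_prob_itv (s a b : R) : 0 < s ->
  normal_prob 0 s `]s * a, s * b]%classic = normal_prob 0 1 `]a, b]%classic.
Proof.
move=> s0; have sN0 : s != 0 by rewrite gt_eqF.
have [ba|ab] := leP b a.
  by rewrite !set_itv_ge ?measure0// bnd_simp -leNgt// ler_pM2l.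
have dF : (fun y : R => y * s)^`()%classic = cst s.
  apply/funext => y; rewrite derive1E deriveM// derive_cst derive_id scaler0.
  by rewrite add0r /GRing.scale/= mulr1.
have mpdf (r : R) (D : set R) : measurable_fun D (fun y => (normal_pdf 0 r y)%:E).
  by apply/measurable_funTS/measurable_EFinP; exact: measurable_normal_pdf.
have cF : continuous (fun y : R => y * s).
  by move=> y; apply: cvgMl; exact: cvg_id.
rewrite /normal_prob !integral_itv_obnd_cbnd// ![s * _]mulrC.
rewrite (@integration_by_substitution_increasing R (fun y => y * s)).
- apply: eq_integral => y _; rewrite dF fctE /= [y * s]mulrC.
  by rewrite normal_pdf_scale.
- exact: ltW.
- by move=> x y _ _ xy; rewrite ltr_pM2r.
- by rewrite dF => ? _; exact: cvg_cst.
- by rewrite dF; exact: is_cvg_cst.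
- by rewrite dF; exact: is_cvg_cst.
- split=> //.
  + by apply: cvg_at_right_filter; exact: cF.
  + by apply: cvg_at_left_filter; exact: cF.
- by apply: continuous_subspaceT; exact: continuous_normal_pdf.
Qed.

(** Both sides are finite measures in [A], so they need only be compared on half-open intervals, a
    generating family stable under intersection and exhausted by the []-k, k]]. This is Brownian
    scaling for one coordinate at one time. *)
Lemma normal_prob_scale (s : R) (A : set R) : 0 < s -> measurable A ->
  normal_prob 0 1 [set y | A (s * y)] = normal_prob 0 s A.
Proof.
move=> s0 mA; have sN0 : s != 0 by rewrite gt_eqF.
have mX : measurable_fun (T := measurableTypeR R) (U := measurableTypeR R)
  setT ( *%R s) by exact: mulrl_measurable.
pose X : {RV (normal_prob 0 1 : probability (measurableTypeR R) R)
    >-> measurableTypeR R} :=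
  @mfun_Sub _ _ (measurableTypeR R) (measurableTypeR R) ( *%R s) (mem_set mX).
symmetry.
apply: (@measure_unique _ R (measurableTypeR R)
  (@measurable _ (ocitv_type R)) (fun k => `]- k%:R, k%:R]%classic)
  _ _ _ _ (normal_prob 0 s) (distribution (normal_prob 0 1) X)) => //.
- by move=> B C mB mC; exact: measurableI.
- by move=> k; exists (- k%:R, k%:R).
- apply/seteqP; split=> // y _; exists (Num.truncn `|y|).+1 => //.
  by rewrite /= in_itv/=; have := truncnS_gt `|y|; rewrite ltr_norml => /andP[-> /ltW].
- move=> B [[a b] _ <-].
  have -> : `]a, b]%classic = `]s * (a / s), s * (b / s)]%classic.
    by rewrite ![s * _]mulrC !divfK.
  transitivity (normal_prob 0 1 `]a / s, b / s]%classic).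
    exact: normal_prob_itv.
  rewrite /distribution /pushforward; congr (normal_prob 0 1 _).
  apply/seteqP; split=> y /=; rewrite !in_itv/=.
    by rewrite ltr_pM2l// ler_pM2l.
  by rewrite ltr_pM2l// ler_pM2l.
- by move=> k; rewrite (le_lt_trans (probability_le1 _ _)) ?ltry.
Qed.

End normal_scaling.

(** * Integration by parts against the Gaussian density *)

Section gaussian_integration_by_parts.
Context (R : realType).
Local Notation mu := (@lebesgue_measure R).

Lemma is_derive_gdens (y : R) : is_derive y 1 (@gdens R) (- (y * gdens y)).
Proof.
have -> : @gdens R = (fun y => (Num.sqrt (2 * pi))^-1 * expR (- (y ^+ 2 / 2))).
  by apply/funext => z; rewrite gdensE.
move: (Num.sqrt _)^-1 => c.
by apply: is_derive_eq; rewrite /GRing.scale/=; field.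
Qed.

(** With [N = n + 1], [exp (N^2 / 2) >= 1 + N^2 / 2 >= N / 2], so the density is squeezed under a
    multiple of [1 / N]. *)
Lemma cvg_gdens : @gdens R n.+1%:R @[n --> \oo] --> 0.
Proof.
pose c : R := (Num.sqrt (2 * pi))^-1.
have c0 : 0 <= c by rewrite invr_ge0 sqrtr_ge0.
have H : c * 2 * n.+1%:R^-1 @[n --> \oo] --> c * 2 * 0.
  by apply: cvgMr; exact: cvg_harmonic.
rewrite mulr0 in H; apply: (squeeze_cvgr _ (cvg_cst 0) H).
apply: nearW => n; rewrite gdens_ge0 gdensE -/c -mulrA ler_wpM2l// expRN.
set N : R := n.+1%:R.
have N1 : 1 <= N by rewrite /N ler1n.
have N0 : 0 < N by exact: lt_le_trans N1.
rewrite -[leRHS]invrK invfM invrK lef_pV2 ?posrE ?expR_gt0//; last first.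
  by rewrite mulrC divr_gt0.
rewrite (le_trans _ (expR_ge1Dx _))//; nra.
Qed.

(** The function [y * gdens y] has the primitive [- gdens y]. Differentiability of [g] is asked only
    in the open interval, so that it may fail at 0 when 0 is an endpoint. *)
Lemma gauss_ibp_itv (a b : R) (g g' : R -> R) : a < b ->
  continuous g -> continuous g' ->
  (forall y, a < y < b -> is_derive y 1 g (g' y)) ->
  \int[mu]_(y in `[a, b]) (g y * (y * gdens y)) =
  gdens a * g a - gdens b * g b + \int[mu]_(y in `[a, b]) (g' y * gdens y).
Proof.
move=> ab cg cg' dg.
have cG : continuous (fun y => - @gdens R y).
  by move=> y; apply: cvgN; exact: continuous_gdens.
have dG (y : R) : is_derive y 1 (fun y => - @gdens R y) (y * gdens y).
  rewrite -[X in is_derive _ _ _ X]opprK.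
  exact: (is_deriveN (is_derive_gdens y)).
have LR (h : R -> R) : continuous h ->
    (forall y, a < y < b -> derivable h y 1) -> derivable_oo_LRcontinuous h a b.
  move=> ch dh; split.
  - by move=> y; rewrite in_itv/=; exact: dh.
  - by apply: cvg_at_right_filter; exact: ch.
  - by apply: cvg_at_left_filter; exact: ch.
rewrite (@Rintegration_by_parts _ g (fun y => - gdens y) g' _ a b)//.
- have -> : \int[mu]_(y in `[a, b]) (g' y * - gdens y) =
      \int[mu]_(y in `[a, b]) (-1 * (g' y * gdens y)).
    by apply: eq_Rintegral => y _; rewrite mulrN mulN1r.
  rewrite RintegralZl//; first by ring.
  apply: continuous_compact_integrable; first exact: segment_compact.
  apply: continuous_subspaceT => y; apply: cvgM; first exact: cg'.
  exact: continuous_gdens.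
- exact: continuous_subspaceT.
- by apply: LR => // y /dg [].
- by move=> y; rewrite in_itv/= derive1E => /dg [].
- apply: continuous_subspaceT => y.
  by apply: cvgM; [exact: cvg_id|exact: continuous_gdens].
- by apply: LR => // y _; have [] := dG y.
- by move=> y _; rewrite derive1E; have [] := dG y.
Qed.

Lemma cvg_Rintegral_itv (f : R -> R) : mu.-integrable setT (EFin \o f) ->
  \int[mu]_(y in `[- n.+1%:R, n.+1%:R]) f y @[n --> \oo] --> \int[mu]_y f y.
Proof.
move=> intf.
have mf : measurable_fun setT f by apply/measurable_EFinP; exact: measurable_int intf.
under eq_fun do rewrite Rintegral_mkcond.
apply: (@dominated_cvg_Rintegral _ _ _ mu _ _ (fun y => `|f y|)).
- move=> n; apply/(measurable_restrictT _ _).1 => //.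
  exact: measurable_funTS.
- move=> y; apply: cvg_near_cst; near=> n.
  rewrite patchE mem_set//= in_itv/= -ler_norml ltW//.
  rewrite (@lt_le_trans _ _ n%:R)// ?ler_nat//.
  by near: n; exact: nbhs_infty_gtr.
- exact: (integrable_norm intf).
- by move=> n y; rewrite patchE; case: ifP => // _; rewrite normr0.
Unshelve. all: by end_near. Qed.

(* The two half-lines are treated separately: the integrand may jump at [0],
   and each side contributes a boundary term there. *)
Lemma gauss_ibp (gp gm gp' gm' : R -> R) (M : R) :
  continuous gp -> continuous gm -> continuous gp' -> continuous gm' ->
  (forall y, `|gp y| <= M) -> (forall y, `|gm y| <= M) ->
  (forall y, `|gp' y| <= M) -> (forall y, `|gm' y| <= M) ->
  (forall y : R, 0 < y -> is_derive y 1 gp (gp' y)) ->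
  (forall y : R, y < 0 -> is_derive y 1 gm (gm' y)) ->
  \int[mu]_y ((if 0 <= y then gp y else gm y) * (y * gdens y)) =
  gdens 0 * (gp 0 - gm 0) +
  \int[mu]_y ((if 0 <= y then gp' y else gm' y) * gdens y).
Proof.
move=> cp cm cp' cm' bp bm bp' bm' dp dm.
have mif (u v : R -> R) : continuous u -> continuous v ->
    measurable_fun setT (fun y : R => if 0 <= y then u y else v y).
  move=> cu cv; apply: measurable_fun_ifT.
  - exact: measurable_fun_ler.
  - exact: continuous_measurable_fun.
  - exact: continuous_measurable_fun.
have bif (u v : R -> R) y : (forall y, `|u y| <= M) -> (forall y, `|v y| <= M) ->
    `|if 0 <= y then u y else v y| <= M by case: ifP.
have int1 (u : R -> R) : measurable_fun setT u -> (forall y, `|u y| <= M) ->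
    mu.-integrable setT (EFin \o (fun y => u y * (y * gdens y))).
  move=> mu' bu.
  apply: (@le_Rintegrable _ _ _ mu _ (fun y => M * (`|y| ^+ 1 * gdens y))).
  - apply: measurable_funM => //; apply: measurable_funM => //.
    exact: measurable_gdens.
  - apply: (integrableZl measurableT M (integrable_moment R 1)).
  - move=> y; rewrite !normrM expr1 (ger0_norm (gdens_ge0 y)).
    by rewrite ler_wpM2r// mulr_ge0// gdens_ge0.
have int0 (u : R -> R) : measurable_fun setT u -> (forall y, `|u y| <= M) ->
    mu.-integrable setT (EFin \o (fun y => u y * gdens y)).
  move=> mu' bu.
  apply: (@le_Rintegrable _ _ _ mu _ (fun y => M * (`|y| ^+ 0 * gdens y))).
  - by apply: measurable_funM => //; exact: measurable_gdens.
  - apply: (integrableZl measurableT M (integrable_moment R 0)).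
  - move=> y; rewrite !normrM expr0 mul1r (ger0_norm (gdens_ge0 y)).
    by rewrite ler_wpM2r// gdens_ge0.
set f1 := fun y => _ * (y * gdens y); set f0 := fun y => _ * gdens y.
have i1 : mu.-integrable setT (EFin \o f1).
  by apply: int1 => [|y]; [exact: mif|exact: bif].
have i0 : mu.-integrable setT (EFin \o f0).
  by apply: int0 => [|y]; [exact: mif|exact: bif].
(* The shift by one keeps both half-intervals nondegenerate, already for [n = 0]. *)
pose N n : R := n.+1%:R.
have N0 n : 0 < N n by [].
have split_itv (h hp hm : R -> R) n :
    mu.-integrable setT (EFin \o h) ->
    mu.-integrable setT (EFin \o hm) ->
    (forall y, 0 <= y -> h y = hp y) -> (forall y, y < 0 -> h y = hm y) ->
    \int[mu]_(y in `[- N n, N n]) h y =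
    \int[mu]_(y in `[- N n, 0]) hm y + \int[mu]_(y in `[0, N n]) hp y.
  move=> ih ihm ep em.
  have E : `[- N n, N n]%classic = `[- N n, 0[%classic `|` `[0, N n]%classic.
    by rewrite -itv_bndbnd_setU// bnd_simp ?oppr_le0// ltW.
  rewrite E Rintegral_setU//; last 2 first.
  - by apply: integrableS ih => //; exact: measurableU.
  - apply/disj_set2P/seteqP; split=> y //= [] /=.
    by rewrite !in_itv/= => /andP[_ y0] /andP[]; rewrite leNgt y0.
  congr (_ + _).
    (* [h] agrees with [hm] only for [y < 0]; the endpoint 0 is negligible, so the left interval can
       be closed. *)
    rewrite -Rintegral_itv_bndo_bndc; last exact: integrableS ihm.
    apply: eq_Rintegral => y; rewrite inE/= in_itv/= => /andP[_ y0].
    exact: em.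
  apply: eq_Rintegral => y; rewrite inE/= in_itv/= => /andP[y0 _].
  exact: ep.
have K n : \int[mu]_(y in `[- N n, N n]) f1 y =
    gdens (- N n) * gm (- N n) - gdens (N n) * gp (N n) +
    gdens 0 * (gp 0 - gm 0) + \int[mu]_(y in `[- N n, N n]) f0 y.
  rewrite (split_itv f1 (fun y => gp y * (y * gdens y))
                        (fun y => gm y * (y * gdens y)))//; last 3 first.
  - by apply: int1 => //; exact: continuous_measurable_fun.
  - by move=> y y0; rewrite /f1 y0.
  - by move=> y y0; rewrite /f1 leNgt y0.
  rewrite (split_itv f0 (fun y => gp' y * gdens y)
                        (fun y => gm' y * gdens y))//; last 3 first.
  - by apply: int0 => //; exact: continuous_measurable_fun.
  - by move=> y y0; rewrite /f0 y0.
  - by move=> y y0; rewrite /f0 leNgt y0.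
  have Nn : - N n < 0 by rewrite oppr_lt0.
  have Em := gauss_ibp_itv Nn cm cm' (fun y h => dm y (andP h).2).
  have Ep := gauss_ibp_itv (N0 n) cp cp' (fun y h => dp y (andP h).1).
  rewrite Em Ep; ring.
have gN y : gdens (- y) = gdens y :> R by rewrite !gdensE sqrrN.
have B : gdens (- N n) * gm (- N n) - gdens (N n) * gp (N n) @[n --> \oo] --> 0.
  apply: norm_cvg0.
  have L : @gdens R (N n) * (M + M) @[n --> \oo] --> 0 * (M + M).
    by apply: cvgMl; exact: cvg_gdens.
  rewrite mul0r in L; apply: (squeeze_cvgr _ (cvg_cst 0) L).
  apply: nearW => n; rewrite normr_ge0/= gN -mulrBr normrM.
  rewrite (ger0_norm (gdens_ge0 _)) ler_wpM2l ?gdens_ge0//.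
  by rewrite (le_trans (ler_normB _ _))// lerD.
have L1 := cvg_Rintegral_itv i1.
have L0 := cvg_Rintegral_itv i0.
apply: (cvg_unique _ L1) => //.
have -> : (fun n => \int[mu]_(y in `[- n.+1%:R, n.+1%:R]) f1 y) = fun n =>
    gdens (- N n) * gm (- N n) - gdens (N n) * gp (N n) +
    gdens 0 * (gp 0 - gm 0) + \int[mu]_(y in `[- N n, N n]) f0 y.
  by apply/funext => n; exact: K.
apply: cvgD => //; rewrite -[X in _ --> X]add0r.
apply: cvgD => //; exact: cvg_cst.
Qed.

End gaussian_integration_by_parts.

(** * The heat semigroup *)

Section continuous_paths.
Context (R : realType) (V : normedModType R).
Implicit Types (a b x : V) (c : R).

Lemma continuous_addZ x c : continuous (fun v : V => x + c *: v).
Proof.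
move=> v; apply: cvgD; first exact: cvg_cst.
by apply: cvgZl_tmp; exact: cvg_id.
Qed.

Lemma continuous_line a b : continuous (fun y : R => y *: a + b).
Proof.
by move=> y; apply: cvgD; [apply: cvgZr_tmp; exact: cvg_id|exact: cvg_cst].
Qed.

Lemma continuous_sqrt_path a :
  continuous (fun p : R * V => p.2 + Num.sqrt p.1 *: a).
Proof.
move=> p; apply: cvgD; first exact: cvg_snd.
apply: cvgZr_tmp.
apply: (@continuous_comp _ _ _ fst Num.sqrt); first exact: cvg_fst.
exact: sqrt_continuous.
Qed.

End continuous_paths.

Section Cb_infty_theory.
Context (R : realType) (n : nat).
Implicit Types (f : 'rV[R]_n -> R) (x v a : 'rV[R]_n).

Lemma Cb_infty_continuous f : Cb_infty f -> continuous f.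
Proof. by move=> [sf _] x; have [+ _] := sf [::]; exact. Qed.

Lemma Cb_infty_derivable f x v : Cb_infty f -> derivable f x v.
Proof. by move=> [sf _]; have [_ +] := sf [::]; exact. Qed.

Lemma Cb_infty_bounded f : Cb_infty f -> exists M, forall x, `|f x| <= M.
Proof. by move=> [_ bf]; exact: (bf [::]). Qed.

Lemma Cb_infty_derive f v : Cb_infty f -> Cb_infty ('D_v f).
Proof. by move=> [sf bf]; split=> vs; [exact: (sf (v :: vs))|exact: (bf (v :: vs))]. Qed.

Lemma Cb_infty_is_derive f x v : Cb_infty f -> is_derive x v f ('D_v f x).
Proof. by move=> Cf; apply: derivableP; exact: Cb_infty_derivable. Qed.

Lemma Cb_infty_derive_row f x v : Cb_infty f ->
  'D_v f x = \sum_(i < n) v 0 i * 'D_(delta_mx 0 i) f x.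
Proof.
move=> Cf; apply: derive_row => [w y|w]; first exact: Cb_infty_derivable.
by apply: Cb_infty_continuous; exact: Cb_infty_derive.
Qed.

Lemma is_derive_shiftr f a x v (df : R) :
  is_derive (x + a) v f df -> is_derive x v (fun q => f (q + a)) df.
Proof.
have E : (fun h : R => h^-1 *: (f (h *: v + x + a) - f (x + a))) =
         (fun h : R => h^-1 *: (f (h *: v + (x + a)) - f (x + a))).
  by apply/funext => h; rewrite addrA.
by move=> [? ?]; apply: DeriveDef; rewrite /derivable/derive E.
Qed.

End Cb_infty_theory.

Section heat_semigroup.
Context d (T : measurableType d) (R : realType) (P : probability T R) (n : nat).
Variable G : 'I_n -> T -> R.
Hypothesis mG : forall i, measurable_fun setT (G i).
Hypothesis lawG : forall i (A : set R), measurable A ->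
  P (G i @^-1` A) = normal_prob 0 1 A.
(** A product formula between one coordinate and a box in the others is the exact input of an
    integration by parts in one coordinate. *)
Hypothesis indG : forall i (A : set R) (B : 'I_n -> set R), measurable A ->
  (forall j, measurable (B j)) ->
  P (G i @^-1` A `&` [set w | forall j, j != i -> B j (G j w)]) =
  (P (G i @^-1` A) * P [set w | forall j, j != i -> B j (G j w)])%E.

Implicit Types (f g h : 'rV[R]_n -> R) (x v : 'rV[R]_n) (c s y : R).
Local Notation mu := (@lebesgue_measure R).

Definition Gvec (w : T) : 'rV[R]_n := \row_i G i w.

Definition heat g s x : R := \int[P]_w g (x + Num.sqrt s *: Gvec w).

Lemma continuous_affine g x c : continuous g ->
  continuous (fun v => g (x + c *: v)).
Proof.
move=> cg v; apply: (@continuous_comp _ _ _ (fun v => x + c *: v) g); last exact: cg.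
exact: continuous_addZ.
Qed.

Lemma measurable_affine g x c (V : 'I_n -> T -> R) : continuous g ->
  (forall i, measurable_fun setT (V i)) ->
  measurable_fun setT (fun w => g (x + c *: \row_i V i w)).
Proof.
move=> cg mV; apply: (measurable_fun_row (f := fun v => g (x + c *: v)) mV).
exact: continuous_affine.
Qed.

Lemma measurable_Gvec g x c : continuous g ->
  measurable_fun setT (fun w => g (x + c *: Gvec w)).
Proof. by move=> cg; exact: (measurable_affine x c cg mG). Qed.

Lemma le_norm_expectation (f : T -> R) (M : R) : measurable_fun setT f ->
  (forall w, `|f w| <= M) -> `|\int[P]_w f w| <= M.
Proof.
move=> mf fM; have intf := integrable_bounded P mf fM.
rewrite (le_trans (le_normr_Rintegral _ intf))//.
rewrite [leRHS](_ : _ = \int[P]_w cst M w); last first.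
  by rewrite Rintegral_cst// [X in fine X](@probability_setT _ _ _ P) mulr1.
apply: le_Rintegral => [//|||w _]; last exact: fM.
  exact: (integrable_norm intf).
exact: finite_measure_integrable_cst.
Qed.

Lemma heat_le g s x (M : R) : continuous g -> (forall x, `|g x| <= M) ->
  `|heat g s x| <= M.
Proof.
by move=> cg gM; apply: le_norm_expectation => [|w]; [exact: measurable_Gvec|exact: gM].
Qed.

Lemma heat0 g x : heat g 0 x = g x.
Proof.
rewrite /heat sqrtr0; under eq_Rintegral do rewrite scale0r addr0.
by rewrite Rintegral_cst// [X in fine X](@probability_setT _ _ _ P) mulr1.
Qed.

(** [Num.sqrt] is continuous on the whole line, being 0 on negative numbers, so continuity holds at
    all [s], in particular up to [s = 0] from both sides. *)
Lemma continuous_heat g (M : R) : continuous g -> (forall x, `|g x| <= M) ->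
  continuous (fun p : R * 'rV[R]_n => heat g p.1 p.2).
Proof.
move=> cg gM p.
apply: (@continuous_Rintegral _ _ _ _ _ (fun p w => g (p.2 + Num.sqrt p.1 *: Gvec w))
  (cst M)) => //.
- by move=> q; exact: measurable_Gvec.
- exact: finite_measure_integrable_cst.
- move=> w; apply: (@continuous_comp _ _ _ (fun p : R * 'rV[R]_n => p.2 + Num.sqrt p.1 *: Gvec w) g); last exact: cg.
  exact: continuous_sqrt_path.
Qed.

Lemma is_derive_heat_space g s x v : Cb_infty g ->
  is_derive x v (heat g s) (heat ('D_v g) s x).
Proof.
move=> Cg; have CDg := Cb_infty_derive v Cg.
have [M gM] := Cb_infty_bounded Cg; have [N DgN] := Cb_infty_bounded CDg.
apply: (is_derive_Rintegral (F := fun q w => g (q + Num.sqrt s *: Gvec w))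
  (F' := fun q w => 'D_v g (q + Num.sqrt s *: Gvec w)) (G := cst N) ltr01).
- move=> h _; apply: integrable_bounded => [|w]; last exact: gM.
  exact: (measurable_Gvec _ _ (Cb_infty_continuous Cg)).
- by move=> h w _; apply: is_derive_shiftr; exact: Cb_infty_is_derive.
- exact: finite_measure_integrable_cst.
- by move=> h w _; exact: DgN.
Qed.

(** Freezing coordinate [i] makes [y] the variable of a one-dimensional integration by parts. *)
Definition replG (i : 'I_n) y (j : 'I_n) (w : T) : R :=
  if j == i then y else G j w.

Lemma measurable_replG i y j : measurable_fun setT (replG i y j).
Proof. by rewrite /replG; case: eqP. Qed.

Lemma replG_self i w : \row_j replG i (G i w) j w = Gvec w.
Proof. by apply/rowP => j; rewrite !mxE /replG; case: eqP => // ->. Qed.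

Lemma replG_line i y w :
  \row_j replG i y j w = y *: delta_mx 0 i + \row_j replG i 0 j w.
Proof.
apply/rowP => j; rewrite !mxE eqxx /= /replG; case: eqP => _.
  by rewrite mulr1 addr0.
by rewrite mulr0 add0r.
Qed.

(** With independent coordinates this is the conditional expectation of [g (x + c *: G)] given
    [G i = y]. *)
Definition heat_repl g x c i y : R :=
  \int[P]_w g (x + c *: \row_j replG i y j w).

Lemma heat_replE g x c i y w : g (x + c *: \row_j replG i y j w) =
  g (y *: (c *: delta_mx 0 i) + (x + c *: \row_j replG i 0 j w)).
Proof.
by rewrite replG_line scalerDr addrCA !scalerA (mulrC c).
Qed.

Lemma heat_repl_le g x c i y (M : R) : continuous g ->
  (forall x, `|g x| <= M) -> `|heat_repl g x c i y| <= M.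
Proof.
move=> cg gM; apply: le_norm_expectation => [|w]; last exact: gM.
by apply: measurable_affine => // j; exact: measurable_replG.
Qed.

Lemma continuous_heat_repl_pointwise g x c i w : continuous g ->
  continuous (fun y => g (x + c *: \row_j replG i y j w)).
Proof.
move=> cg y; under eq_fun do rewrite heat_replE.
apply: (@continuous_comp _ _ _ (fun y : R => y *: (c *: delta_mx 0 i) + (x + c *: \row_j replG i 0 j w)) g); last exact: cg.
exact: continuous_line.
Qed.

Lemma continuous_heat_repl g x c i (M : R) : continuous g ->
  (forall x, `|g x| <= M) -> continuous (heat_repl g x c i).
Proof.
move=> cg gM y.
apply: (@continuous_Rintegral _ _ _ _ _
  (fun y w => g (x + c *: \row_j replG i y j w)) (cst M)) => //.
- by move=> q; apply: measurable_affine => // j; exact: measurable_replG.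
- exact: finite_measure_integrable_cst.
- by move=> w; exact: continuous_heat_repl_pointwise.
Qed.

Lemma is_derive_heat_repl g x c i y : Cb_infty g ->
  is_derive y 1 (heat_repl g x c i)
    (c * heat_repl ('D_(delta_mx 0 i) g) x c i y).
Proof.
move=> Cg; set e := delta_mx 0 i.
have CDg := Cb_infty_derive e Cg.
have [M gM] := Cb_infty_bounded Cg; have [N DgN] := Cb_infty_bounded CDg.
have mr h (Ch : Cb_infty h) z :
    measurable_fun setT (fun w => h (x + c *: \row_j replG i z j w)).
  apply: (measurable_affine _ _ (Cb_infty_continuous Ch)) => j.
  exact: measurable_replG.
rewrite -RintegralZl//; last exact: (integrable_bounded P (mr _ CDg y)).
apply: (is_derive_Rintegral (F := fun y w => g (x + c *: \row_j replG i y j w))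
  (F' := fun y w => c * 'D_e g (x + c *: \row_j replG i y j w))
  (G := cst (`|c| * N)) ltr01).
- move=> h _; apply: integrable_bounded => [|w]; last exact: gM.
  exact: mr.
- move=> h w _; under eq_fun do rewrite heat_replE.
  rewrite (heat_replE ('D_e g)); apply/(is_derive_line g).
  apply: is_derive_scaler.
  exact: Cb_infty_is_derive.
- exact: finite_measure_integrable_cst.
- by move=> h w _ /=; rewrite normrM ler_wpM2l.
Qed.

Lemma indep_replG i (B : set R) y f (M : R) : measurable B -> continuous f ->
  (forall v, `|f v| <= M) ->
  \int[P]_w (\1_(G i @^-1` B) w * f (\row_j replG i y j w)) =
  fine (P (G i @^-1` B)) * \int[P]_w f (\row_j replG i y j w).
Proof.
move=> mB cf fM.
have mA : measurable (G i @^-1` B).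
  by rewrite -[X in measurable X]setTI; exact: mG.
have H (C : 'I_n -> set R) : (forall j, measurable (C j)) ->
    1 * fine (P (G i @^-1` B `&` [set w | forall j, C j (replG i y j w)])) =
    fine (P (G i @^-1` B)) *
      fine (P (setT `&` [set w | forall j, C j (replG i y j w)])).
  move=> mC; rewrite mul1r setTI.
  (* The constraint at index [i] bears on the constant [y]. If it holds, a box in the other
     coordinates remains and [indG] applies; otherwise the event is empty and both sides vanish. *)
  have [Ciy|nCiy] := pselect (C i y).
    have -> : [set w | forall j, C j (replG i y j w)] =
              [set w | forall j, j != i -> C j (G j w)].
      apply/seteqP; split=> w /= H j.
        by move=> /negbTE ji; have := H j; rewrite /replG ji.
      by rewrite /replG; case: eqP => [->//|/eqP]; exact: H.
    have mS : measurable [set w | forall j, j != i -> C j (G j w)].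
      rewrite (_ : [set _ | _] =
          [set w | forall j, (if j == i then setT else C j) (G j w)]).
        apply: (measurable_box (B := fun j => if j == i then setT else C j)) => //.
        by move=> j; case: ifP.
      apply/seteqP; split=> w /= H j; have := H j; case: (eqVneq j i) => //.
      by move=> _; exact.
    by rewrite indG// fineM//; exact: fin_num_measure.
  have -> : [set w | forall j, C j (replG i y j w)] = set0.
    apply/seteqP; split=> w //= H; apply: nCiy.
    by have := H i; rewrite /replG eqxx.
  by rewrite setI0 measure0 mulr0.
have := Rintegral_eq_boxes mA measurableT (measurable_replG i y)
  (measurable_replG i y) H cf fM.
rewrite mul1r => ->.
by congr (_ * _); apply: eq_Rintegral => w _; rewrite indicT mul1r.
Qed.

(** Freezing of [G i], followed by its normal law. The factor [a] will be the identity on one side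
    of Stein's identity and the constant 1 on the other; the growth bound admits both. *)
Lemma expectation_repl (a : R -> R) g x c i (M : R) : continuous a ->
  (forall y, `|a y| <= `|y| + 1) -> continuous g -> (forall x, `|g x| <= M) ->
  \int[P]_w (a (G i w) * g (x + c *: Gvec w)) =
  \int[mu]_y (a y * heat_repl g x c i y * gdens y).
Proof.
move=> ca a1 cg gM.
have M0 : 0 <= M by rewrite (le_trans _ (gM 0)).
pose F y w := a y * g (x + c *: \row_j replG i y j w).
have -> : \int[P]_w (a (G i w) * g (x + c *: Gvec w)) = \int[P]_w F (G i w) w.
  by apply: eq_Rintegral => w _; rewrite /F replG_self.
have mr y : measurable_fun setT (fun w => g (x + c *: \row_j replG i y j w)).
  by apply: measurable_affine => // j; exact: measurable_replG.
have HF y : \int[P]_w F y w = a y * heat_repl g x c i y.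
  by rewrite RintegralZl//; exact: (integrable_bounded P (mr y)).
have Fle y w : `|F y w| <= M * (`|y| + 1).
  by rewrite normrM mulrC ler_pM.
rewrite (@freezing _ _ _ P F (G i) M) => //.
- under eq_Rintegral do rewrite HF.
  rewrite (@Rintegral_normal_law _ _ _ P (G i) 1 (mG i) ltr01 (lawG i)
    (fun y => a y * heat_repl g x c i y) M).
  + by apply: eq_Rintegral => y _; rewrite mul1r.
  + move=> y; apply: cvgM; first exact: ca.
    exact: (continuous_heat_repl cg gM).
  + move=> y; rewrite normrM mulrC ler_pM//.
    exact: heat_repl_le.
- exact: (integrable_normal_law (mG i) ltr01 (lawG i)).
- move=> w y; apply: cvgM; first exact: ca.
  exact: continuous_heat_repl_pointwise.
- by move=> y; apply: measurable_funM.
- move=> y B mB.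
  apply: (@indep_replG i B y (fun v => a y * g (x + c *: v)) (`|a y| * M)) => //.
    move=> v; apply: (@continuous_comp _ _ _ (fun v => g (x + c *: v))
      ( *%R (a y))); first exact: continuous_affine.
    exact: mulrl_continuous.
  by move=> v; rewrite normrM ler_wpM2l.
Qed.

(* Gaussian integration by parts in the coordinate [i], the other coordinates
   being frozen. *)
Lemma stein g x c i : Cb_infty g ->
  \int[P]_w (G i w * g (x + c *: Gvec w)) =
  c * \int[P]_w ('D_(delta_mx 0 i) g (x + c *: Gvec w)).
Proof.
move=> Cg; set e := delta_mx 0 i; have CDg := Cb_infty_derive e Cg.
have [M gM] := Cb_infty_bounded Cg; have [N DgN] := Cb_infty_bounded CDg.
have cg := Cb_infty_continuous Cg; have cDg := Cb_infty_continuous CDg.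
have cid : continuous (id : R -> R) by move=> y; exact: cvg_id.
have id1 (y : R) : `|id y| <= `|y| + 1 by rewrite /= lerDl.
have c1 : continuous (cst 1 : R -> R) by move=> y; exact: cvg_cst.
have le1 (y : R) : `|cst 1 y : R| <= `|y| + 1 by rewrite /= normr1 lerDr.
rewrite (@expectation_repl id g x c i M cid id1 cg gM).
have -> : \int[P]_w ('D_e g (x + c *: Gvec w)) =
    \int[P]_w (cst 1 (G i w) * 'D_e g (x + c *: Gvec w)).
  by apply: eq_Rintegral => w _; rewrite mul1r.
rewrite (@expectation_repl (cst 1) ('D_e g) x c i N c1 le1 cDg DgN).
pose psi := heat_repl g x c i; pose dpsi y := c * heat_repl ('D_e g) x c i y.
have cpsi : continuous psi by exact: continuous_heat_repl gM.
have cdpsi : continuous dpsi.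
  by move=> y; apply: cvgMr; exact: (continuous_heat_repl cDg DgN).
have bpsi y : `|psi y| <= Num.max M (`|c| * N).
  by rewrite le_max heat_repl_le.
have bdpsi y : `|dpsi y| <= Num.max M (`|c| * N).
  by rewrite le_max normrM ler_wpM2l ?orbT// heat_repl_le.
have dp (y : R) : is_derive y 1 psi (dpsi y) by exact: is_derive_heat_repl.
(* The same function is used on both half-lines, so the boundary term at 0 cancels. *)
have := gauss_ibp cpsi cpsi cdpsi cdpsi bpsi bpsi bdpsi bdpsi
  (fun y _ => dp y) (fun y _ => dp y).
rewrite subrr mulr0 add0r.
have -> : \int[mu]_y ((if 0 <= y then psi y else psi y) * (y * gdens y)) =
    \int[mu]_y (y * heat_repl g x c i y * gdens y).
  by apply: eq_Rintegral => y _; rewrite if_same mulrCA mulrA.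
move=> ->; rewrite -RintegralZl//.
  by apply: eq_Rintegral => y _; rewrite if_same /dpsi /= mul1r mulrA.
apply: (@le_Rintegrable _ _ _ mu _ (fun y => N * (`|y| ^+ 0 * gdens y))).
- apply: measurable_funM; last exact: measurable_gdens.
  apply: continuous_measurable_fun => y /=; apply: cvgM; first exact: cvg_cst.
  exact: (continuous_heat_repl cDg DgN).
- apply: (integrableZl measurableT N (integrable_moment R 0)).
- move=> y; rewrite normrM expr0 /= !mul1r (ger0_norm (gdens_ge0 y)).
  by rewrite ler_wpM2r ?gdens_ge0// heat_repl_le.
Qed.

(** Differentiating inside the expectation gives [1 / (2 * sqrt s)] times the sum of the
    [G i * 'D_i g]. Stein's identity trades each [G i] for a factor [sqrt s] and a second
    derivative; the square roots cancel and 1/2 is left. *)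
Lemma is_derive_heat_time g s x : Cb_infty g -> 0 < s ->
  is_derive s 1 (fun r => heat g r x)
    (2^-1 * \sum_(i < n)
      heat ('D_(delta_mx 0 i) ('D_(delta_mx 0 i) g)) s x).
Proof.
move=> Cg s0; pose e i : 'rV[R]_n := delta_mx 0 i.
have CDg i := Cb_infty_derive (e i) Cg.
have [M gM] := Cb_infty_bounded Cg.
have /choice[N DgN] i := Cb_infty_bounded (CDg i).
have N0 i : 0 <= N i by rewrite (le_trans _ (DgN i 0)).
pose F' r w := (2 * Num.sqrt r)^-1 *
  \sum_(i < n) (G i w * 'D_(e i) g (x + Num.sqrt r *: Gvec w)).
have iG i : P.-integrable setT (EFin \o G i).
  exact: (integrable_normal_law (mG i) ltr01 (lawG i)).
have iGg r i : P.-integrable setT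
    (EFin \o (fun w => G i w * 'D_(e i) g (x + Num.sqrt r *: Gvec w))).
  apply: (@le_Rintegrable _ _ _ P _ (fun w => N i * `|G i w|)).
  - apply: measurable_funM; first exact: mG.
    exact: (measurable_Gvec _ _ (Cb_infty_continuous (CDg i))).
  - exact: (integrableZl measurableT (N i) (integrable_norm (iG i))).
  - by move=> w; rewrite normrM mulrC ler_wpM2r// DgN.
have -> : 2^-1 * \sum_(i < n) heat ('D_(e i) ('D_(e i) g)) s x =
    \int[P]_w F' s w.
  rewrite RintegralZl//; last first.
    by apply: integrable_sumr => i; exact: iGg.
  rewrite Rintegral_sum// !mulr_sumr; apply: eq_bigr => i _.
  rewrite (stein x (Num.sqrt s) i (CDg i)) mulrA; congr (_ * _).
  have : Num.sqrt s != 0 by rewrite gt_eqF// sqrtr_gt0.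
  by move: (Num.sqrt s) => t t0; field.
(* Within [s / 2] of [s] the time stays at least [s / 2], so [(2 * sqrt r)^-1] is at most the
   constant [C] below. *)
have s2 : 0 < s / 2 by rewrite divr_gt0.
have near_s (h : R) : `|h| < s / 2 -> s / 2 <= h *: 1 + s.
  rewrite /GRing.scale/= mulr1 ltr_norml => /andP[]; lra.
pose C : R := (2 * Num.sqrt (s / 2))^-1.
apply: (@is_derive_Rintegral _ _ _ P _ (fun r w => g (x + Num.sqrt r *: Gvec w))
  F' (fun w => C * \sum_(i < n) (N i * `|G i w|)) s 1 (s / 2) s2).
- move=> h _; apply: integrable_bounded => [|w]; last exact: gM.
  exact: (measurable_Gvec _ _ (Cb_infty_continuous Cg)).
- move=> h w /near_s hs; set r := h *: 1 + s.
  have r0 : 0 < r by exact: lt_le_trans hs.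
  rewrite /F' mulrC.
  (* The sum is the derivative of [g] along the random vector itself, to which the chain rule with
     [sqrt r] applies. *)
  have -> : \sum_(i < n) (G i w * 'D_(e i) g (x + Num.sqrt r *: Gvec w)) =
      'D_(Gvec w) g (Num.sqrt r *: Gvec w + x).
    rewrite Cb_infty_derive_row// addrC.
    by apply: eq_bigr => i _; rewrite mxE.
  apply: (@is_derive1_comp _ (fun a : R => g (x + a *: Gvec w)) Num.sqrt).
    under eq_fun do rewrite addrC.
    by apply/(is_derive_line g); exact: Cb_infty_is_derive.
  exact: is_derive1_sqrt.
- have iN i : P.-integrable setT (EFin \o (fun w => N i * `|G i w|)).
    exact: (integrableZl measurableT (N i) (integrable_norm (iG i))).
  exact: (integrableZl measurableT C (integrable_sumr _ iN)).
- move=> h w /near_s hs; rewrite /F'; set r := h *: 1 + s.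
  have r0 : 0 < r by exact: lt_le_trans hs.
  rewrite normrM ger0_norm ?invr_ge0 ?mulr_ge0 ?sqrtr_ge0//.
  rewrite ler_pM ?invr_ge0 ?mulr_ge0 ?sqrtr_ge0//.
    rewrite /C lef_pV2 ?posrE ?mulr_gt0 ?sqrtr_gt0//.
    by rewrite ler_wpM2l// ler_wsqrtr.
  rewrite (le_trans (ler_norm_sum _ _ _))// ler_sum// => i _.
  by rewrite normrM mulrC ler_wpM2r// DgN.
Qed.

End heat_semigroup.

(** * Mixtures and smoothness *)

Section partial_derivatives.
Context (R : realType) (V : normedModType R).
Implicit Types (f : R * V -> R) (p : R * V).

Lemma is_derive_pair_snd f p (v : V) (df : R) :
  is_derive p.2 v (fun x => f (p.1, x)) df -> is_derive p (0, v) f df.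
Proof.
have E : (fun h : R => h^-1 *: (f (h *: (0, v) + p) - f p)) =
         (fun h : R => h^-1 *: (f (p.1, h *: v + p.2) - f (p.1, p.2))).
  case: p => p1 p2; apply/funext => h; congr (_ *: (f _ - _)).
  by congr pair; rewrite /= scaler0 add0r.
by move=> [? ?]; apply: DeriveDef; rewrite /derivable/derive E.
Qed.

Lemma is_derive_pair_fst f p (df : R) :
  is_derive p.1 1 (fun t => f (t, p.2)) df -> is_derive p (1, 0) f df.
Proof.
have E : (fun h : R => h^-1 *: (f (h *: ((1 : R), (0 : V)) + p) - f p)) =
         (fun h : R => h^-1 *: (f (h *: 1 + p.1, p.2) - f (p.1, p.2))).
  case: p => p1 p2; apply/funext => h; congr (_ *: (f _ - _)).
  by congr pair; rewrite /= scaler0 add0r.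
by move=> [? ?]; apply: DeriveDef; rewrite /derivable/derive E.
Qed.

Lemma near_gt0_fst p : 0 < p.1 -> \forall q \near p, 0 < q.1.
Proof.
move=> p0; have : fst @ p --> p.1 by exact: cvg_fst.
by move/cvgr_gt; exact.
Qed.

End partial_derivatives.

Section continuous_radial.
Context (R : realType) (V : normedModType R).

Lemma continuous_radial (c : R) (x : V) :
  continuous (fun y : R => (c * `|y|, x)).
Proof.
move=> y.
have H : c * `|z| @[z --> y] --> c * `|y| by apply: cvgMr; exact: norm_continuous.
have Hx : x @[_ --> y] --> x by exact: cvg_cst.
exact: (cvg_pair H Hx).
Qed.

Lemma continuous_radial_pair (c : R) :
  continuous (fun p : R * V => (Num.sqrt p.1 * c, p.2)).
Proof.
move=> p.
have H : Num.sqrt q.1 * c @[q --> p] --> Num.sqrt p.1 * c.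
  apply: cvgMl.
  apply: (@continuous_comp _ _ _ fst Num.sqrt); first exact: cvg_fst.
  exact: sqrt_continuous.
have H2 : q.2 @[q --> p] --> p.2 by exact: cvg_snd.
exact: (cvg_pair H H2).
Qed.

End continuous_radial.

Section gaussian_mixture.
Context d (T : measurableType d) (R : realType) (P : probability T R) (n : nat).
Variable G : 'I_n -> T -> R.
Hypothesis mG : forall i, measurable_fun setT (G i).
Hypothesis lawG : forall i (A : set R), measurable A ->
  P (G i @^-1` A) = normal_prob 0 1 A.
Hypothesis indG : forall i (A : set R) (B : 'I_n -> set R), measurable A ->
  (forall j, measurable (B j)) ->
  P (G i @^-1` A `&` [set w | forall j, j != i -> B j (G j w)]) =
  (P (G i @^-1` A) * P [set w | forall j, j != i -> B j (G j w)])%E.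

Implicit Types (g : 'rV[R]_n -> R) (x v : 'rV[R]_n) (p q : R * 'rV[R]_n).
Local Notation mu := (@lebesgue_measure R).
Local Notation heat := (heat P G).

Definition weight k (y : R) : R := `|y| ^+ k * gdens y.

Lemma weight_ge0 k y : 0 <= weight k y.
Proof. by rewrite mulr_ge0 ?exprn_ge0// gdens_ge0. Qed.

Lemma measurable_weight k : measurable_fun setT (weight k).
Proof.
apply: measurable_funM; last exact: measurable_gdens.
by apply: measurable_funX; exact: normr_measurable.
Qed.

Definition mixture k g p : R :=
  \int[mu]_y (weight k y * heat g (Num.sqrt p.1 * `|y|) p.2).

Lemma continuous_heat_radial g t x : Cb_infty g ->
  continuous (fun y : R => heat g (Num.sqrt t * `|y|) x).
Proof.
move=> Cg; have [M gM] := Cb_infty_bounded Cg.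
move=> y; apply: (@continuous_comp _ _ _ (fun y : R => (Num.sqrt t * `|y|, x))
  (fun p => heat g p.1 p.2)).
  exact: continuous_radial.
exact: (continuous_heat mG (Cb_infty_continuous Cg) gM).
Qed.

Lemma measurable_mixture k g t x : Cb_infty g ->
  measurable_fun setT (fun y => weight k y * heat g (Num.sqrt t * `|y|) x).
Proof.
move=> Cg; apply: measurable_funM; first exact: measurable_weight.
apply: continuous_measurable_fun; exact: continuous_heat_radial.
Qed.

Lemma mixture_le k g t x (M : R) : Cb_infty g -> (forall x, `|g x| <= M) ->
  forall y, `|weight k y * heat g (Num.sqrt t * `|y|) x| <= M * weight k y.
Proof.
move=> Cg gM y; rewrite normrM (ger0_norm (weight_ge0 _ _)) mulrC.
rewrite ler_wpM2r ?weight_ge0//.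
exact: (heat_le P mG _ _ (Cb_infty_continuous Cg) gM).
Qed.

Lemma integrable_weight k (M : R) :
  mu.-integrable setT (EFin \o (fun y => M * weight k y)).
Proof. exact: (integrableZl measurableT M (integrable_moment R k)). Qed.

Lemma integrable_mixture k g t x : Cb_infty g ->
  mu.-integrable setT
    (EFin \o (fun y => weight k y * heat g (Num.sqrt t * `|y|) x)).
Proof.
move=> Cg; have [M gM] := Cb_infty_bounded Cg.
apply: (@le_Rintegrable _ _ _ mu _ (fun y => M * weight k y)).
- exact: measurable_mixture.
- exact: integrable_weight.
- exact: mixture_le.
Qed.

Lemma continuous_mixture k g : Cb_infty g -> continuous (mixture k g).
Proof.
move=> Cg; have [M gM] := Cb_infty_bounded Cg => p.
apply: (@continuous_Rintegral _ _ _ mu _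
  (fun p y => weight k y * heat g (Num.sqrt p.1 * `|y|) p.2)
  (fun y => M * weight k y)).
- by move=> q; exact: measurable_mixture.
- exact: integrable_weight.
- by move=> q; exact: mixture_le.
- move=> y; apply: (@continuous_comp _ _ _
    (fun p => heat g (Num.sqrt p.1 * `|y|) p.2) ( *%R (weight k y))).
    apply: (@continuous_comp _ _ _ (fun p => (Num.sqrt p.1 * `|y|, p.2))
      (fun p => heat g p.1 p.2)).
      exact: continuous_radial_pair.
    exact: (continuous_heat mG (Cb_infty_continuous Cg) gM).
  exact: mulrl_continuous.
Qed.

Lemma is_derive_mixture_space k g p v : Cb_infty g ->
  is_derive p (0, v) (mixture k g) (mixture k ('D_v g) p).
Proof.
move=> Cg; have CDg := Cb_infty_derive v Cg.
have [M DgM] := Cb_infty_bounded CDg.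
apply: is_derive_pair_snd; rewrite /mixture /=.
apply: (@is_derive_Rintegral _ _ _ mu _
  (fun x y => weight k y * heat g (Num.sqrt p.1 * `|y|) x)
  (fun x y => weight k y * heat ('D_v g) (Num.sqrt p.1 * `|y|) x)
  (fun y => M * weight k y) p.2 v 1 ltr01).
- by move=> h _; exact: integrable_mixture.
- move=> h y _; rewrite -[X in is_derive _ _ _ X]/(weight k y *: _).
  by apply: is_deriveZ; exact: is_derive_heat_space.
- exact: integrable_weight.
- by move=> h y _; exact: mixture_le.
Qed.

(** The inner derivative [|y| / (2 * sqrt t)] raises the exponent of the weight by one; its 2 and
    the 1/2 of the heat equation make the 4. *)
Lemma is_derive_mixture_time k g p : Cb_infty g -> 0 < p.1 ->
  is_derive p (1, 0) (mixture k g) ((4 * Num.sqrt p.1)^-1 *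
    \sum_(i < n) mixture k.+1 ('D_(delta_mx 0 i) ('D_(delta_mx 0 i) g)) p).
Proof.
move=> Cg; case: p => t x /= t0.
pose D i := 'D_(delta_mx 0 i) ('D_(delta_mx 0 i) g).
have CD i : Cb_infty (D i) by do 2 apply: Cb_infty_derive.
have /choice[N DN] i := Cb_infty_bounded (CD i).
pose F' r y := (4 * Num.sqrt r)^-1 *
  \sum_(i < n) (weight k.+1 y * heat (D i) (Num.sqrt r * `|y|) x).
have -> : (4 * Num.sqrt t)^-1 * \sum_(i < n) mixture k.+1 (D i) (t, x) =
    \int[mu]_y F' t y.
  have im i := integrable_mixture k.+1 t x (CD i).
  by rewrite RintegralZl ?Rintegral_sum//; exact: integrable_sumr.
apply: is_derive_pair_fst; rewrite /mixture /=.
have t2 : 0 < t / 2 by rewrite divr_gt0.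
have near_t (h : R) : `|h| < t / 2 -> t / 2 <= h *: 1 + t.
  rewrite /GRing.scale/= mulr1 ltr_norml => /andP[]; lra.
pose C : R := (4 * Num.sqrt (t / 2))^-1.
apply: (@is_derive_Rintegral _ _ _ mu _
  (fun r y => weight k y * heat g (Num.sqrt r * `|y|) x) F'
  (fun y => C * \sum_(i < n) (N i * weight k.+1 y)) t 1 (t / 2) t2).
- by move=> h _; exact: integrable_mixture.
- move=> h y /near_t ht; set r := h *: 1 + t.
  have r0 : 0 < r by exact: lt_le_trans ht.
  have [->|y0] := eqVneq y 0.
    rewrite /F' big1 ?mulr0; last first.
      by move=> i _; rewrite /weight normr0 exprS !mul0r.
    under eq_fun do rewrite normr0 mulr0.
    exact: is_derive_cst.
  have sy0 : 0 < Num.sqrt r * `|y| by rewrite mulr_gt0 ?sqrtr_gt0 ?normr_gt0.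
  have dsq : is_derive r 1 (fun r => Num.sqrt r * `|y|)
      (`|y| * (2 * Num.sqrt r)^-1).
    have := is_derive1_sqrt r0 => ds.
    have -> : (fun r => Num.sqrt r * `|y|) = (`|y| \*: Num.sqrt).
      by apply/funext => z; rewrite /= mulrC.
    exact: is_deriveZ.
  have dh := @is_derive1_comp _ (fun s => heat g s x)
    (fun r => Num.sqrt r * `|y|) r _ _
    (is_derive_heat_time mG lawG indG x Cg sy0) dsq.
  have -> : F' r y = weight k y *: (2^-1 * (\sum_(i < n)
      heat (D i) (Num.sqrt r * `|y|) x) * (`|y| * (2 * Num.sqrt r)^-1)).
    rewrite /F' /GRing.scale/= -mulr_sumr /weight exprS.
    have : Num.sqrt r != 0 by rewrite gt_eqF// sqrtr_gt0.
    by move: (Num.sqrt r) (\sum_(i < n) _) => s S s1; field.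
  exact: is_deriveZ.
- exact: (integrableZl measurableT C (integrable_sumr _
    (fun i => integrable_weight k.+1 (N i)))).
- move=> h y /near_t ht; rewrite /F'; set r := h *: 1 + t.
  have r0 : 0 < r by exact: lt_le_trans ht.
  rewrite normrM ger0_norm ?invr_ge0 ?mulr_ge0 ?sqrtr_ge0//.
  rewrite ler_pM ?invr_ge0 ?mulr_ge0 ?sqrtr_ge0//.
    rewrite /C lef_pV2 ?posrE ?mulr_gt0 ?sqrtr_gt0//.
    by rewrite ler_wpM2l// ler_wsqrtr.
  rewrite (le_trans (ler_norm_sum _ _ _))// ler_sum// => i _.
  exact: mixture_le.
Qed.

Lemma mixture0E g x : Cb_infty g -> mixture 0 g (0, x) = g x.
Proof.
move=> Cg; rewrite /mixture /= sqrtr0.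
under eq_Rintegral do rewrite mul0r (heat0 P G) /weight expr0 mul1r mulrC.
rewrite RintegralZl//; last exact: integrable_normal_pdf.
by rewrite /Rintegral integral_normal_pdf mulr1.
Qed.

(* The boundary term at [y = 0], where the density is [(2 pi)^(-1/2)], is the
   source of the inhomogeneity in the Cauchy problem. *)
Lemma mixture_ibp g p : Cb_infty g -> 0 < p.1 ->
  mixture 1 g p = 2 * gdens 0 * g p.2 + Num.sqrt p.1 * (2^-1 *
    \sum_(i < n) mixture 0 ('D_(delta_mx 0 i) ('D_(delta_mx 0 i) g)) p).
Proof.
move=> Cg; case: p => t x /= t0.
pose D i := 'D_(delta_mx 0 i) ('D_(delta_mx 0 i) g).
have CD i : Cb_infty (D i) by do 2 apply: Cb_infty_derive.
have /choice[N DN] i := Cb_infty_bounded (CD i).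
have [M gM] := Cb_infty_bounded Cg.
have st0 : 0 < Num.sqrt t by rewrite sqrtr_gt0.
pose psi (y : R) := heat g (Num.sqrt t * `|y|) x.
pose dpsi (y : R) := Num.sqrt t * (2^-1 *
  \sum_(i < n) heat (D i) (Num.sqrt t * `|y|) x).
have cpsi : continuous psi by exact: continuous_heat_radial.
have cpsiN : continuous (fun y => - psi y) by move=> y; apply: cvgN; exact: cpsi.
have cdpsi : continuous dpsi.
  move=> y; apply: cvgMr; apply: cvgMr.
  apply: cvg_big => [|i _]; first exact: add_continuous.
  exact: continuous_heat_radial.
pose B := Num.max M (Num.sqrt t * (2^-1 * \sum_(i < n) N i)).
have bpsi y : `|psi y| <= B.
  by rewrite le_max (heat_le P mG _ _ (Cb_infty_continuous Cg) gM).
have bpsiN y : `|- psi y| <= B by rewrite normrN.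
have bdpsi y : `|dpsi y| <= B.
  rewrite le_max; apply/orP; right.
  rewrite normrM ger0_norm ?sqrtr_ge0// ler_wpM2l ?sqrtr_ge0//.
  rewrite normrM ger0_norm ?invr_ge0// ler_wpM2l ?invr_ge0//.
  rewrite (le_trans (ler_norm_sum _ _ _))// ler_sum// => i _.
  exact: (heat_le P mG _ _ (Cb_infty_continuous (CD i)) (DN i)).
have dp (y : R) : 0 < y -> is_derive y 1 psi (dpsi y).
  move=> y0; have sy0 : 0 < Num.sqrt t * y by rewrite mulr_gt0.
  have dl : is_derive y 1 ( *%R (Num.sqrt t)) (Num.sqrt t).
    by apply: is_derive_eq; rewrite /GRing.scale/= mulr1.
  have := @is_derive1_comp _ (fun s => heat g s x) ( *%R (Num.sqrt t)) y _ _
    (is_derive_heat_time mG lawG indG x Cg sy0) dl.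
  rewrite mulrC /dpsi gtr0_norm// => H.
  apply: near_eq_is_derive H; near=> z; rewrite /psi /= gtr0_norm//.
  by near: z; exact: lt_nbhsr.
have dm (y : R) : y < 0 -> is_derive y 1 (fun y => - psi y) (dpsi y).
  move=> y0; have Ny0 : 0 < - y by rewrite oppr_gt0.
  have dN : is_derive y 1 -%R (-1 : R) by exact: is_derive_eq.
  have := @is_derive1_comp _ psi -%R y _ _ (dp _ Ny0) dN.
  rewrite mulrN1 => /is_deriveN; rewrite opprK /dpsi normrN.
  have -> // : - (psi \o -%R) = (fun y => - psi y).
  by apply/funext => z; rewrite /psi /= !fctE /= normrN.
(* The odd extension, [psi] on the right and [- psi] on the left, turns the weight [|y|] into [y].
   Both branches have derivative [dpsi], and their jump at 0 is [2 * psi 0]. *)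
have := gauss_ibp cpsi cpsiN cdpsi cdpsi bpsi bpsiN bdpsi bdpsi dp dm.
have -> : \int[mu]_y ((if 0 <= y then psi y else - psi y) * (y * gdens y)) =
    mixture 1 g (t, x).
  apply: eq_Rintegral => y _; rewrite /weight expr1 /psi /=.
  case: ifPn => [y0|]; first by rewrite ger0_norm// mulrC.
  by rewrite -ltNge => y0; rewrite ltr0_norm//; ring.
move=> ->; congr (_ + _).
  by rewrite opprK /psi normr0 mulr0 heat0; ring.
rewrite [RHS]mulrA.
transitivity (\int[mu]_y ((Num.sqrt t * 2^-1) * \sum_(i < n)
    (weight 0 y * heat (D i) (Num.sqrt t * `|y|) x))).
  apply: eq_Rintegral => y _; rewrite if_same /dpsi -mulr_sumr /weight expr0.
  by ring.
have im i := integrable_mixture 0 t x (CD i).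
rewrite RintegralZl//; last exact: integrable_sumr.
by rewrite Rintegral_sum.
Unshelve. all: by end_near. Qed.

End gaussian_mixture.

(** * A class of functions stable under differentiation *)

Section smoothness.
Context d (T : measurableType d) (R : realType) (P : probability T R) (n : nat).
Variable G : 'I_n -> T -> R.
Hypothesis mG : forall i, measurable_fun setT (G i).
Hypothesis lawG : forall i (A : set R), measurable A ->
  P (G i @^-1` A) = normal_prob 0 1 A.
Hypothesis indG : forall i (A : set R) (B : 'I_n -> set R), measurable A ->
  (forall j, measurable (B j)) ->
  P (G i @^-1` A `&` [set w | forall j, j != i -> B j (G j w)]) =
  (P (G i @^-1` A) * P [set w | forall j, j != i -> B j (G j w)])%E.

Implicit Types (g : 'rV[R]_n -> R) (p q : R * 'rV[R]_n).
Implicit Types (F f : R * 'rV[R]_n -> R).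
Local Notation mixture := (mixture P G).

(** The inductive form makes stability under differentiation an induction with one case for
    generators and one for binary combinations; scalings and the zero function come from zero
    coefficients. *)
Inductive mixture_span : (R * 'rV[R]_n -> R) -> Prop :=
| mixture_span_base j k g : Cb_infty g ->
    mixture_span (fun p => (Num.sqrt p.1)^-1 ^+ j * mixture k g p)
| mixture_span_lin a b F1 F2 : mixture_span F1 -> mixture_span F2 ->
    mixture_span (fun p => a * F1 p + b * F2 p).

Lemma mixture_span_scale a F : mixture_span F ->
  mixture_span (fun p => a * F p).
Proof.
move=> sF; have := mixture_span_lin a 0 sF sF.
by under eq_fun do rewrite mul0r addr0.
Qed.

Lemma mixture_span_add F1 F2 : mixture_span F1 -> mixture_span F2 ->
  mixture_span (fun p => F1 p + F2 p).
Proof.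
move=> s1 s2; have := mixture_span_lin 1 1 s1 s2.
by under eq_fun do rewrite !mul1r.
Qed.

(** The member [F0] serves the empty sum: the zero function is obtained as [0 * F0]. *)
Lemma mixture_span_sum F0 (I : Type) (s : seq I) (F : I -> R * 'rV[R]_n -> R) :
  mixture_span F0 -> (forall i, mixture_span (F i)) ->
  mixture_span (fun p => \sum_(i <- s) F i p).
Proof.
move=> s0 sF; elim: s => [|i s IH].
  under eq_fun do rewrite big_nil.
  have := mixture_span_scale 0 s0.
  by under eq_fun do rewrite mul0r.
under eq_fun do rewrite big_cons.
exact: mixture_span_add.
Qed.

Lemma is_derive_sqrtVX j (t : R) : 0 < t ->
  is_derive t 1 (fun t : R => (Num.sqrt t)^-1 ^+ j)
    (- (j%:R / 2) * (Num.sqrt t)^-1 ^+ j.+2).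
Proof.
move=> t0; have s0 : Num.sqrt t != 0 by rewrite gt_eqF// sqrtr_gt0.
have dV := is_deriveV s0 (is_derive1_sqrt t0).
have -> : (fun t : R => (Num.sqrt t)^-1 ^+ j) = (fun t => (Num.sqrt t)^-1) ^+ j.
  by apply/funext => z; rewrite exprfctE.
apply: (is_derive_eq (is_deriveX j dV)).
case: j => [|j]; first by rewrite !mul0r oppr0 mul0r scale0r.
rewrite /GRing.scale/= !exprS.
by move: (Num.sqrt t) s0 => s s0; move: (s^-1 ^+ j) => r; field.
Qed.

Lemma continuous_sqrtVX j p : 0 < p.1 ->
  {for p, continuous (fun p : R * 'rV[R]_n => (Num.sqrt p.1)^-1 ^+ j)}.
Proof.
move=> p0; have [dj _] := is_derive_sqrtVX j p0.
apply: (@continuous_comp _ _ _ fst (fun t : R => (Num.sqrt t)^-1 ^+ j)).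
  exact: cvg_fst.
by apply: differentiable_continuous; apply/derivable1_diffP.
Qed.

Lemma mixture_span_continuous F p : mixture_span F -> 0 < p.1 ->
  {for p, continuous F}.
Proof.
move=> sF p0; elim: sF => [j k g Cg|a b F1 F2 _ c1 _ c2].
  apply: (@continuousM _ _ (fun p => (Num.sqrt p.1)^-1 ^+ j) (mixture k g)).
    exact: continuous_sqrtVX.
  exact: continuous_mixture.
by apply: continuousD; apply: continuousM => //; exact: cst_continuous.
Qed.

(** The direction is split into its time and space parts. The time derivative exists nearby and is
    continuous at [p], so [is_deriveDv] adds the space derivative, known at [p] alone. *)
Lemma is_derive_pair (F DF : R * 'rV[R]_n -> R) (dx : R) p (v : R * 'rV[R]_n) :
  0 < p.1 -> {for p, continuous DF} ->
  (forall q, 0 < q.1 -> is_derive q (1, 0) F (DF q)) ->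
  is_derive p (0, v.2) F dx -> is_derive p v F (v.1 * DF p + dx).
Proof.
case: v => v1 v2 /= p0 cDF dt dF.
have -> : (v1, v2) = v1 *: ((1 : R), (0 : 'rV[R]_n)) + (0, v2).
  congr pair; rewrite /= ?scaler0 ?add0r//.
  by rewrite /GRing.scale/= mulr1 addr0.
apply: (is_deriveDv (f' := fun q => v1 * DF q)) => //.
- apply: filterS (near_gt0_fst p0) => q q0.
  by apply: is_derive_scaler; exact: dt.
- by apply: continuousM => //; exact: cst_continuous.
Qed.

Lemma mixture_span_derive F (v : R * 'rV[R]_n) : mixture_span F ->
  exists2 F', mixture_span F' & forall p, 0 < p.1 -> is_derive p v F (F' p).
Proof.
elim=> [j k g Cg|a b F1 F2 s1 [F1' s1' d1] s2 [F2' s2' d2]]; last first.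
  exists (fun p => a * F1' p + b * F2' p); first exact: mixture_span_lin.
  move=> p p0; have D1 := d1 p p0; have D2 := d2 p p0.
  exact: (is_deriveD (is_deriveZ a D1) (is_deriveZ b D2)).
pose D i := 'D_(delta_mx 0 i) ('D_(delta_mx 0 i) g).
have CD i : Cb_infty (D i) by do 2 apply: Cb_infty_derive.
pose r (p : R * 'rV[R]_n) := (Num.sqrt p.1)^-1.
(* Product rule in time: the first term differentiates [t^(-j/2)], and in the second the factor
   [1 / (4 * sqrt t)] of the mixture derivative is absorbed as one more power of [1 / sqrt t]. *)
pose Ft p := - (j%:R / 2) * (r p ^+ j.+2 * mixture k g p) +
  4^-1 * \sum_(i < n) (r p ^+ j.+1 * mixture k.+1 (D i) p).
pose Fx p := r p ^+ j * mixture k ('D_(v.2) g) p.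
have sFt : mixture_span Ft.
  apply: mixture_span_lin; first exact: mixture_span_base.
  apply: mixture_span_sum; first exact: (mixture_span_base 0 0 Cg).
  by move=> i; exact: mixture_span_base.
have sFx : mixture_span Fx.
  by apply: mixture_span_base; exact: Cb_infty_derive.
exists (fun p => v.1 * Ft p + Fx p).
  by apply: mixture_span_add => //; exact: mixture_span_scale.
have dr q w : is_derive q (0, w) (fun p => r p ^+ j) 0.
  apply: is_derive_pair_snd; rewrite /r /=.
  exact: (is_derive_cst ((Num.sqrt q.1)^-1 ^+ j)).
move=> p p0; apply: is_derive_pair => //.
- exact: mixture_span_continuous.
- move=> q q0.
  have dq : is_derive q (1, 0) (fun p => r p ^+ j) (- (j%:R / 2) * r q ^+ j.+2).
    by apply: is_derive_pair_fst; exact: is_derive_sqrtVX.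
  have dm := is_derive_mixture_time mG lawG indG k Cg q0.
  apply: (is_derive_eq (is_deriveM dq dm)).
  rewrite /Ft -mulr_sumr /GRing.scale/= addrC; congr (_ + _).
    by rewrite mulrC -mulrA.
  by rewrite invfM exprS -/(r q); ring.
- have dm := is_derive_mixture_space P mG k p v.2 Cg.
  apply: (is_derive_eq (is_deriveM (dr p v.2) dm)).
  by rewrite /GRing.scale/= mulr0 addr0.
Qed.

(** Agreement on the open half-space holds near each of its points, hence passes to derivatives.
    This locality matters because [u] is identified with a mixture for nonnegative times only. *)
Lemma mixture_span_iter_dderiv (vs : seq (R * 'rV[R]_n)) F f :
  mixture_span F -> (forall p, 0 < p.1 -> f p = F p) ->
  exists2 F', mixture_span F' &
    forall p, 0 < p.1 -> iter_dderiv f vs p = F' p.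
Proof.
elim: vs F f => [|v vs IH] F f sF fF; first by exists F.
have [F' sF' dF'] := mixture_span_derive v sF.
apply: (IH F') => // p p0.
have [_ <-] := dF' p p0; apply: near_eq_derive.
by apply: filterS (near_gt0_fst p0) => q; exact: fF.
Qed.

Lemma mixture_span_smooth F f : mixture_span F ->
  (forall p, 0 < p.1 -> f p = F p) ->
  smooth_on [set p : R * 'rV[R]_n | 0 < p.1] f.
Proof.
move=> sF fF vs; have [F' sF' fF'] := mixture_span_iter_dderiv vs sF fF.
have near_eq p : 0 < p.1 -> \forall q \near p, F' q = iter_dderiv f vs q.
  by move=> p0; apply: filterS (near_gt0_fst p0) => q q0; rewrite fF'.
split=> [p /= p0|p v /= p0].
  rewrite /continuous_at /prop_for fF'//.
  apply: (cvg_trans (near_eq_cvg (near_eq p p0))).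
  exact: mixture_span_continuous.
have [F'' _ dF''] := mixture_span_derive v sF'.
apply: (near_eq_derivable (near_eq p p0)).
by have [] := dF'' p p0.
Qed.

End smoothness.

(** * Iterated Brownian motion *)

Section independence.
Context d (T : measurableType d) (R : realType) (P : probability T R).

(** Transports independence from lists of processes to events indexed by a finite type, with [lab]
    choosing a different process for each index. *)
Lemma independent_family (I : eqType) (F : I -> set (set T)) (K : finType)
  (lab : K -> I) (E : K -> set T) :
  mutually_independent P F -> injective lab -> (forall k, F (lab k) (E k)) ->
  P [set w | forall k, E k w] = (\prod_k P (E k))%E.
Proof.
move=> indF inj FE.
(* The default [setT] is never met: the intersection runs over the labels in the image of [lab]. *)
pose A c := if [pick k | lab k == c] is Some k then E k else setT.
have AE k : A (lab k) = E k.
  rewrite /A; case: pickP => [k' /eqP/inj -> //|/(_ k)].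
  by rewrite eqxx.
have U : uniq [seq lab k | k <- enum K] by rewrite map_inj_uniq// enum_uniq.
have FA c : c \in [seq lab k | k <- enum K] -> F c (A c).
  by move=> /mapP[k _ ->]; rewrite AE.
have -> : [set w | forall k, E k w] =
    \bigcap_(c in [set` [seq lab k | k <- enum K]]) A c.
  apply/seteqP; split=> w /= H.
    by move=> c /mapP[k _ ->]; rewrite AE.
  by move=> k; rewrite -AE; apply: H; rewrite /= map_f// mem_enum.
rewrite (indF _ U A FA) big_map big_enum /=.
by apply: eq_bigr => k _; rewrite AE.
Qed.

(** The full product formula is applied twice, to the given events and to the same events with the
    one at [k0] replaced by the whole space. *)
Lemma independent_split (I : eqType) (F : I -> set (set T)) (K : finType)
  (lab : K -> I) (E : K -> set T) (k0 : K) :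
  mutually_independent P F -> injective lab -> (forall k, F (lab k) (E k)) ->
  F (lab k0) setT ->
  P (E k0 `&` [set w | forall k, k != k0 -> E k w]) =
  (P (E k0) * P [set w | forall k, k != k0 -> E k w])%E.
Proof.
move=> indF inj FE F0.
pose E' k := if k == k0 then setT else E k.
have -> : E k0 `&` [set w | forall k, k != k0 -> E k w] =
    [set w | forall k, E k w].
  apply/seteqP; split=> w /= => [[H0 H] k|H]; last by split.
  by have [->|] := eqVneq k k0; [|exact: H].
have -> : [set w | forall k, k != k0 -> E k w] = [set w | forall k, E' k w].
  apply/seteqP; split=> w /= H k; have := H k; rewrite /E'; case: eqVneq => //.
  by move=> _; exact.
rewrite (independent_family indF inj FE) (independent_family indF inj (E := E')).
  rewrite (bigD1 k0)//= (bigD1 k0 (F := fun k => P (E' k)))//=.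
  rewrite /E' eqxx probability_setT mul1e; congr (_ * _)%E.
  by apply: eq_bigr => k /negbTE ->.
by move=> k; rewrite /E'; case: eqVneq => [->|].
Qed.

Lemma sigma_gen_preimage (J : Type) (D : set J) (X : J -> T -> R) j (A : set R) :
  D j -> measurable A -> sigma_gen D X (X j @^-1` A).
Proof.
move=> Dj mA; apply: sub_sigma_algebra; exists j => //.
by exists A => //; rewrite setTI.
Qed.

Lemma sigma_gen_setT (J : Type) (D : set J) (X : J -> T -> R) j :
  D j -> sigma_gen D X setT.
Proof. by move=> Dj; exact: (@sigma_gen_preimage J D X j setT Dj measurableT). Qed.

Lemma is_BM_law (B : R -> T -> R) (t : R) (A : set R) : is_BM P B -> 0 < t ->
  measurable A -> P (B t @^-1` A) = normal_prob 0 (Num.sqrt t) A.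
Proof.
move=> [B0 _ _ law _] t0 mA; have := law 0 t (lexx 0) t0 A mA.
rewrite subr0 => <-; congr (P _); apply/seteqP.
by split=> w /=; rewrite B0 subr0.
Qed.

(** Paths are controlled at nonnegative times only; the clamp [max s 0] produces a function
    continuous on the whole line. *)
Lemma continuous_comp_max0 (h : R -> R) :
  {within [set t : R | 0 <= t], continuous h} ->
  continuous (fun s : R => h (Num.max s 0)).
Proof.
move=> /subspace_continuousP ch s.
have s0 : 0 <= Num.max s 0 by rewrite le_max lexx orbT.
have cmax : Num.max r 0 @[r --> s] --> Num.max s 0.
  have -> : (fun r : R => Num.max r 0) = (fun r => (r + `|r|) / 2).
    by apply/funext => r; rewrite maxr_absE !subr0 addr0.
  rewrite maxr_absE !subr0 addr0; apply: cvgMl; apply: cvgD; first exact: cvg_id.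
  exact: norm_continuous.
have W : Num.max r 0 @[r --> s] --> within [set t : R | 0 <= t] (nbhs (Num.max s 0)).
  move=> U HU.
  have K : nbhs s (fun r => 0 <= Num.max r 0 -> U (Num.max r 0)) := cmax _ HU.
  change (nbhs s (fun r => U (Num.max r 0))).
  by apply: filterS K => r; apply; rewrite le_max lexx orbT.
exact: (cvg_comp _ h W (ch _ s0)).
Qed.

End independence.

(** * From iterated Brownian motion to Gaussian mixtures *)

Section iterated_BM.
Context (R : realType) (n : nat) d (T : measurableType d) (P : probability T R).
Variables (Xp Xm : 'I_n -> R -> T -> R) (Y : R -> T -> R).
Hypothesis model : iterated_BM_model P Xp Xm Y.
Local Notation tsBM := (two_sided_BM Xp Xm).
Local Notation proc := (ibm_proc Xp Xm Y).
Implicit Types f : 'rV[R]_n -> R.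

Let bm c : is_BM P (proc c). Proof. by have [+ _] := model; exact. Qed.

Let indep : mutually_independent P
  (fun c => sigma_gen [set t : R | 0 <= t] (proc c)).
Proof. by have [] := model. Qed.

(** The standard Gaussian vector [G] of the heat semigroup, realized on the given space. *)
Definition BM1 (i : 'I_n) : T -> R := Xp i 1.

Lemma measurable_proc c t : 0 <= t -> measurable_fun setT (proc c t).
Proof. by have [_ _ + _ _] := bm c; exact. Qed.

Lemma measurable_BM1 i : measurable_fun setT (BM1 i).
Proof. exact: (measurable_proc (inl (inl i)) ler01). Qed.

Lemma BM1_law i (A : set R) : measurable A ->
  P (BM1 i @^-1` A) = normal_prob 0 1 A.
Proof.
by move=> mA; rewrite (is_BM_law (bm (inl (inl i))) ltr01 mA) sqrtr1.
Qed.

Lemma BM1_indep i (A : set R) (B : 'I_n -> set R) : measurable A ->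
  (forall j, measurable (B j)) ->
  P (BM1 i @^-1` A `&` [set w | forall j, j != i -> B j (BM1 j w)]) =
  (P (BM1 i @^-1` A) * P [set w | forall j, j != i -> B j (BM1 j w)])%E.
Proof.
move=> mA mB.
pose E j := BM1 j @^-1` (if j == i then A else B j).
have Ei : E i = BM1 i @^-1` A by rewrite /E eqxx.
have -> : [set w | forall j, j != i -> B j (BM1 j w)] =
    [set w | forall j, j != i -> E j w].
  by apply/seteqP; split=> w /= H j ji; have := H j ji; rewrite /E (negbTE ji).
rewrite -Ei; apply: (independent_split (lab := fun j : 'I_n => inl (inl j)) indep).
- by move=> j k [].
- move=> j; apply: (sigma_gen_preimage (X := proc (inl (inl j))) (j := 1)) => //=.
  by case: ifP.
- by apply: (sigma_gen_setT (j := 1)); exact: ler01.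
Qed.

(** Both branches start at 0, so the glued path is a sum of two clamped paths and its continuity at
    0 needs no case analysis. *)
Lemma two_sided_BME i s w :
  tsBM i s w = Xp i (Num.max s 0) w + Xm i (Num.max (- s) 0) w.
Proof.
have [Xp0 _ _ _ _] := bm (inl (inl i)); have [Xm0 _ _ _ _] := bm (inl (inr i)).
rewrite /two_sided_BM; have [s0|s0] := leP 0 s.
  have -> : Num.max (- s) 0 = 0 by apply/max_idPr; rewrite oppr_le0.
  by have := Xm0 w; rewrite /= => ->; rewrite addr0.
have -> : Num.max (- s) 0 = - s by apply/max_idPl; rewrite oppr_ge0 ltW.
by have := Xp0 w; rewrite /= => ->; rewrite add0r.
Qed.

Lemma continuous_two_sided_BM i w : continuous (fun s => tsBM i s w).
Proof.
have [_ cp _ _ _] := bm (inl (inl i)); have [_ cm _ _ _] := bm (inl (inr i)).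
under eq_fun do rewrite two_sided_BME.
move=> s; apply: cvgD.
  exact: (continuous_comp_max0 (cp w)).
have cN : {for s, continuous (-%R : R -> R)} by exact: oppr_continuous.
have cM : {for - s, continuous (fun r : R => Xm i (Num.max r 0) w)}.
  exact: (continuous_comp_max0 (cm w)).
exact: (continuous_comp cN cM).
Qed.

Lemma continuous_two_sided_path x w :
  continuous (fun s => x + \row_i tsBM i s w : 'rV[R]_n).
Proof.
have -> : (fun s => x + \row_i tsBM i s w : 'rV[R]_n) =
    (fun s => x + 1 *: \sum_(i < n) tsBM i s w *: (delta_mx 0 i : 'rV[R]_n)).
  apply/funext => s; rewrite scale1r; congr (_ + _); rewrite [LHS]row_sum_delta.
  by apply: eq_bigr => i _; rewrite mxE.
move=> s; apply: (@continuous_comp _ _ _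
  (fun s => \sum_(i < n) tsBM i s w *: (delta_mx 0 i : 'rV[R]_n))
  (fun v => x + 1 *: v)); last exact: continuous_addZ.
apply: cvg_big => [|i _]; first exact: add_continuous.
by apply: cvgZr_tmp; exact: continuous_two_sided_BM.
Qed.

(** At a fixed time [y] all coordinates read the same one of the two motions, so they carry distinct
    labels and independence applies. *)
Definition side (y : R) (i : 'I_n) : ('I_n + 'I_n + unit)%type :=
  if 0 <= y then inl (inl i) else inl (inr i).

Lemma side_inj y : injective (side y).
Proof. by move=> i j; rewrite /side; case: ifP => _ []. Qed.

Lemma two_sided_proc y i : tsBM i y = proc (side y i) `|y|.
Proof.
apply/funext => w; rewrite /two_sided_BM /side; case: ifPn => [y0|].
  by rewrite ger0_norm.
by rewrite -ltNge => y0; rewrite ltr0_norm.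
Qed.

Lemma measurable_two_sided_BM y i : measurable_fun setT (tsBM i y).
Proof. by rewrite two_sided_proc; exact: measurable_proc. Qed.

(** At fixed [y] the vector has, on boxes, the law of [sqrt |y|] times [BM1]: both probabilities are
    products over coordinates, and the factors agree by scaling. Agreement on boxes gives equal
    expectations. *)
Lemma two_sided_heat f (M : R) y x : continuous f -> (forall x, `|f x| <= M) ->
  \int[P]_w f (x + \row_i tsBM i y w) = heat P BM1 f `|y| x.
Proof.
(* At [y = 0] the law is a point mass rather than a normal law, and both sides reduce to [f x]. *)
move=> cf fM; have [->|y0] := eqVneq y 0.
  rewrite normr0 heat0; transitivity (\int[P]_w cst (f x) w).
    apply: eq_Rintegral => w _; congr f.
    apply/rowP => i; rewrite !mxE /two_sided_BM lexx.
    by have [/= -> _ _ _ _] := bm (inl (inl i)); rewrite addr0.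
  by rewrite Rintegral_cst// [X in fine X](@probability_setT _ _ _ P) mulr1.
have y1 : 0 < `|y| by rewrite normr_gt0.
have s0 : 0 < Num.sqrt `|y| by rewrite sqrtr_gt0.
pose V i w := Num.sqrt `|y| * BM1 i w.
have mV i : measurable_fun setT (V i).
  by apply: measurable_funM => //; exact: measurable_BM1.
have H (B : 'I_n -> set R) : (forall i, measurable (B i)) ->
    1 * fine (P (setT `&` [set w | forall i, B i (tsBM i y w)])) =
    1 * fine (P (setT `&` [set w | forall i, B i (V i w)])).
  move=> mB; rewrite !mul1r !setTI; congr fine.
  rewrite (independent_family (lab := side y) (E := fun i => tsBM i y @^-1` B i)
    indep); last 2 first.
  - exact: side_inj.
  - move=> i; rewrite two_sided_proc.
    by apply: (sigma_gen_preimage (X := proc (side y i)) (j := `|y|)) => //=.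
  have mBs i : measurable [set z | B i (Num.sqrt `|y| * z)].
    rewrite -[X in measurable X]setTI.
    have mm : measurable_fun setT ( *%R (Num.sqrt `|y|)).
      exact: mulrl_measurable.
    exact: (mm measurableT _ (mB i)).
  rewrite (independent_family (lab := fun i : 'I_n => inl (inl i))
    (E := fun i => BM1 i @^-1` [set z | B i (Num.sqrt `|y| * z)]) indep);
    last 2 first.
  - by move=> i j [].
  - move=> i; apply: (sigma_gen_preimage (X := proc (inl (inl i))) (j := 1)) => //=.
  apply: eq_bigr => i _; rewrite BM1_law// two_sided_proc.
  by rewrite (is_BM_law (bm _) y1 (mB i)) normal_prob_scale.
pose g (v : 'rV[R]_n) := f (x + v).
have cg : continuous g.
  have := continuous_affine (x := x) (c := 1) cf.
  by under eq_fun do rewrite scale1r.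
have gM v : `|g v| <= M by exact: fM.
have := Rintegral_eq_boxes measurableT measurableT
  (measurable_two_sided_BM y) mV H cg gM.
rewrite !mul1r; under eq_Rintegral do rewrite indicT mul1r.
under [X in _ = X -> _]eq_Rintegral do rewrite indicT mul1r.
rewrite /g => ->; apply: eq_Rintegral => w _; congr (f (_ + _)).
by apply/rowP => i; rewrite !mxE.
Qed.

(** The factorization that [freezing] requires of the inner motion at time [t] and the outer motion
    at a fixed [y]. *)
Lemma indep_Y f (M : R) t y x (B : set R) : 0 <= t -> measurable B ->
  continuous f -> (forall x, `|f x| <= M) ->
  \int[P]_w (\1_(Y t @^-1` B) w * f (x + \row_i tsBM i y w)) =
  fine (P (Y t @^-1` B)) * \int[P]_w f (x + \row_i tsBM i y w).
Proof.
move=> t0 mB cf fM.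
have mA : measurable (Y t @^-1` B).
  by rewrite -[X in measurable X]setTI; exact: (measurable_proc (inr tt) t0).
have H (C : 'I_n -> set R) : (forall i, measurable (C i)) ->
    1 * fine (P (Y t @^-1` B `&` [set w | forall i, C i (tsBM i y w)])) =
    fine (P (Y t @^-1` B)) *
      fine (P (setT `&` [set w | forall i, C i (tsBM i y w)])).
  move=> mC; rewrite mul1r setTI.
  (* [None] stands for the inner process, [Some i] for coordinate [i] of the outer one. *)
  pose lab (k : option 'I_n) : ('I_n + 'I_n + unit)%type :=
    if k is Some i then side y i else inr tt.
  pose E (k : option 'I_n) : set T :=
    if k is Some i then tsBM i y @^-1` C i else Y t @^-1` B.
  have -> : [set w | forall i, C i (tsBM i y w)] =
      [set w | forall k, k != None -> E k w].
    apply/seteqP; split=> w /= H; first by move=> [i _|//]; exact: H.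
    by move=> i; exact: (H (Some i) isT).
  have -> : Y t @^-1` B = E None by [].
  rewrite (independent_split (lab := lab) (k0 := None) indep).
  - rewrite fineM// fin_num_measure//.
    rewrite (_ : [set w | _] = [set w | forall i, C i (tsBM i y w)]).
      by apply: measurable_box => // i; exact: measurable_two_sided_BM.
    apply/seteqP; split=> w /= H; last by move=> [i _|//]; exact: H.
    by move=> i; exact: (H (Some i) isT).
  - move=> [i|] [j|] //=; first by move/side_inj ->.
      by rewrite /side; case: ifP.
    by rewrite /side; case: ifP.
  - move=> [i|] /=.
      rewrite two_sided_proc.
      by apply: (sigma_gen_preimage (X := proc (side y i)) (j := `|y|)) => //=.
    by apply: (sigma_gen_preimage (X := Y) (j := t)).
  - by apply: (sigma_gen_setT (j := 0)); exact: lexx.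
pose g (v : 'rV[R]_n) := f (x + v).
have cg : continuous g.
  have := continuous_affine (x := x) (c := 1) cf.
  by under eq_fun do rewrite scale1r.
have gM v : `|g v| <= M by exact: fM.
have := Rintegral_eq_boxes mA measurableT (measurable_two_sided_BM y)
  (measurable_two_sided_BM y) H cg gM.
rewrite mul1r => ->; congr (_ * _).
by apply: eq_Rintegral => w _; rewrite indicT mul1r.
Qed.

Lemma ibm_uE f (p : R * 'rV[R]_n) : Cb_infty f -> 0 <= p.1 ->
  ibm_u P Xp Xm Y f p = mixture P BM1 0 f p.
Proof.
case: p => t x /= Cf t0; have cf := Cb_infty_continuous Cf.
have [M fM] := Cb_infty_bounded Cf.
pose F y w := f (x + \row_i tsBM i y w).
have -> : ibm_u P Xp Xm Y f (t, x) = \int[P]_w F (Y t w) w.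
  rewrite /ibm_u unlock /Rintegral; congr fine; apply: eq_integral => w _.
  by congr (f _)%:E; apply/rowP => i; rewrite !mxE.
(* At [t = 0] the law of the inner motion is degenerate; both sides then equal [f x] because [Y]
   starts at 0. *)
move: t0; rewrite le_eqVlt => /predU1P[<-|t0].
  rewrite mixture0E//; transitivity (\int[P]_w F 0 w).
    apply: eq_Rintegral => w _; congr (F _ w).
    by have [Y0 _ _ _ _] := bm (inr tt); exact: Y0.
  by rewrite (two_sided_heat 0 x cf fM) normr0 heat0.
have st0 : 0 < Num.sqrt t by rewrite sqrtr_gt0.
have mY : measurable_fun setT (Y t) by exact: (measurable_proc (inr tt) (ltW t0)).
have lawY (A : set R) : measurable A ->
    P (Y t @^-1` A) = normal_prob 0 (Num.sqrt t) A.
  exact: (is_BM_law (bm (inr tt)) t0).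
have M0 : 0 <= M by rewrite (le_trans _ (fM 0)).
have le1 (y : R) : M <= M * (`|y| + 1) by rewrite ler_peMr// lerDr.
rewrite (@freezing _ _ _ P F (Y t) M) => //.
- under eq_Rintegral do rewrite (two_sided_heat _ x cf fM).
  rewrite (@Rintegral_normal_law _ _ _ P (Y t) (Num.sqrt t) mY st0 lawY
    (fun y => heat P BM1 f `|y| x) M).
  + apply: eq_Rintegral => y _.
    by rewrite normrM (gtr0_norm st0) /weight expr0 mul1r mulrC.
  + have := continuous_heat_radial measurable_BM1 (P := P) (t := 1) (x := x) Cf.
    by under eq_fun do rewrite sqrtr1 mul1r.
  + move=> y; rewrite (le_trans _ (le1 y))//.
    exact: (heat_le P measurable_BM1 _ _ cf fM).
- exact: (integrable_normal_law mY st0 lawY).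
- move=> w y; apply: (@continuous_comp _ _ _
    (fun y => x + \row_i tsBM i y w) f); last exact: cf.
  exact: continuous_two_sided_path.
- move=> y; rewrite (_ : F y = fun w => f (x + 1 *: \row_i tsBM i y w)).
    by apply: measurable_affine => // i; exact: measurable_two_sided_BM.
  by apply/funext => w; rewrite scale1r.
- by move=> y w; rewrite (le_trans _ (le1 y)) ?fM.
- by move=> y B mB; apply: (indep_Y y x (ltW t0) mB cf fM).
Qed.

End iterated_BM.

(** * The fourth-order equation *)

Section mixture_equation.
Context d (T : measurableType d) (R : realType) (P : probability T R) (n : nat).
Variable G : 'I_n -> T -> R.
Hypothesis mG : forall i, measurable_fun setT (G i).
Hypothesis lawG : forall i (A : set R), measurable A ->
  P (G i @^-1` A) = normal_prob 0 1 A.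
Hypothesis indG : forall i (A : set R) (B : 'I_n -> set R), measurable A ->
  (forall j, measurable (B j)) ->
  P (G i @^-1` A `&` [set w | forall j, j != i -> B j (G j w)]) =
  (P (G i @^-1` A) * P [set w | forall j, j != i -> B j (G j w)])%E.

Implicit Types (g f : 'rV[R]_n -> R) (p : R * 'rV[R]_n).
Local Notation mixture := (mixture P G).
Local Notation "''D2_' i g" :=
  ('D_(delta_mx 0 i) ('D_(delta_mx 0 i) g)) (at level 10, i, g at level 9).

Lemma derive_mixture_sum (m : nat) (g : 'I_m -> 'rV[R]_n -> R)
  (F : R * 'rV[R]_n -> R) p v : (forall l, Cb_infty (g l)) ->
  (forall q, 0 < q.1 -> F q = \sum_(l < m) mixture 0 (g l) q) -> 0 < p.1 ->
  'D_((0 : R, v)) F p = \sum_(l < m) mixture 0 ('D_v (g l)) p.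
Proof.
move=> Cg FE p0.
have -> : 'D_((0 : R, v)) F p = 'D_((0 : R, v)) (\sum_(l < m) mixture 0 (g l)) p.
  apply: near_eq_derive; apply: filterS (near_gt0_fst p0) => q /FE ->.
  by rewrite fct_sumE.
have dm l := is_derive_mixture_space P mG 0 p v (Cg l).
by have [_ ->] := is_derive_sum (fun l => dm l).
Qed.

(** Stated for sums so that it can be iterated: [m = 1] gives the Laplacian of [u], and [m = n]
    applied to the result gives the bi-Laplacian. *)
Lemma laplacian_mixture_sum (m : nat) (g : 'I_m -> 'rV[R]_n -> R)
  (F : R * 'rV[R]_n -> R) p : (forall l, Cb_infty (g l)) ->
  (forall q, 0 < q.1 -> F q = \sum_(l < m) mixture 0 (g l) q) -> 0 < p.1 ->
  laplacian_x F p = \sum_(i < n) \sum_(l < m) mixture 0 ('D2_i (g l)) p.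
Proof.
move=> Cg FE p0; apply: eq_bigr => i _.
apply: (derive_mixture_sum (g := fun l => 'D_(delta_mx 0 i) (g l))) => //.
  by move=> l; exact: Cb_infty_derive.
by move=> q q0; exact: derive_mixture_sum.
Qed.

Lemma mixture_le_cst f (M : R) : Cb_infty f -> (forall x, `|f x| <= M) ->
  exists C : R, forall p, `|mixture 0 f p| <= C.
Proof.
move=> Cf fM; exists (\int[@lebesgue_measure R]_y (M * weight 0 y)) => -[t x].
have im := integrable_mixture P mG 0 t x Cf.
rewrite (le_trans (le_normr_Rintegral _ im))//.
apply: le_Rintegral => [//|||y _].
- exact: (integrable_norm im).
- exact: integrable_weight.
- exact: (mixture_le P mG).
Qed.

(** The time derivative is [1 / (4 * sqrt t)] times a sum of [mixture 1] terms. Integrated by parts,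
    these give [2 * gdens 0] times the Laplacian of [f] plus [sqrt t / 2] times the bi-Laplacian of
    [u]: hence 1/8, and 1/2 over [sqrt (2 * pi * t)]. *)
Lemma mixture_pde f (u : R * 'rV[R]_n -> R) p : Cb_infty f ->
  (forall q, 0 < q.1 -> u q = mixture 0 f q) -> 0 < p.1 ->
  8^-1 * laplacian_x (laplacian_x u) p - deriv_t u p =
  - (2^-1 * ((Num.sqrt (2 * pi * p.1))^-1 * laplacian f p.2)).
Proof.
move=> Cf uE p0.
have CD i : Cb_infty ('D2_i f) by do 2 apply: Cb_infty_derive.
have L1 q : 0 < q.1 -> laplacian_x u q = \sum_(i < n) mixture 0 ('D2_i f) q.
  move=> q0; rewrite (@laplacian_mixture_sum 1 (fun=> f) u q)//.
    by apply: eq_bigr => i _; rewrite big_ord1.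
  by move=> r r0; rewrite big_ord1 uE.
pose A := \sum_(i < n) \sum_(j < n) mixture 0 ('D2_j ('D2_i f)) p.
have L2 : laplacian_x (laplacian_x u) p = A.
  (* The finite sums come in the opposite order: [A] has the inner Laplacian outermost, to match
     [S]. *)
  rewrite /A [RHS]exchange_big; exact: (laplacian_mixture_sum CD L1 p0).
have Dt : deriv_t u p = (4 * Num.sqrt p.1)^-1 *
    \sum_(i < n) mixture 1 ('D2_i f) p.
  have [_ <-] := is_derive_mixture_time mG lawG indG 0 Cf p0.
  apply: near_eq_derive; apply: filterS (near_gt0_fst p0) => q.
  exact: uE.
have S : \sum_(i < n) mixture 1 ('D2_i f) p =
    2 * gdens 0 * laplacian f p.2 + Num.sqrt p.1 * (2^-1 * A).
  rewrite /laplacian /A !mulr_sumr -big_split; apply: eq_bigr => i _.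
  exact: (mixture_ibp mG lawG indG (CD i) p0).
rewrite L2 Dt S gdensE expr0n mul0r oppr0 expR0 mulr1.
rewrite (sqrtrM p.1) ?mulr_ge0 ?pi_ge0//.
have s0 : Num.sqrt p.1 != 0 by rewrite gt_eqF// sqrtr_gt0.
have c0 : Num.sqrt (2 * pi) != 0 :> R.
  by rewrite gt_eqF// sqrtr_gt0 mulr_gt0// pi_gt0.
move: (Num.sqrt p.1) (Num.sqrt (2 * pi)) A (laplacian f p.2) s0 c0
  {L2 S Dt} => s c A B s0 c0.
by field; rewrite c0 s0.
Qed.

End mixture_equation.

Theorem theorem1p1 (R : realType) (n : nat) (d : measure_display)
  (T : measurableType d) (P : probability T R)
  (Xp Xm : 'I_n -> R -> T -> R) (Y : R -> T -> R) (f : 'rV[R]_n -> R) :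
  (0 < n)%N ->
  iterated_BM_model P Xp Xm Y ->
  Cb_infty f ->
  let u := ibm_u P Xp Xm Y f in
  [/\ smooth_on [set p : R * 'rV[R]_n | 0 < p.1] u,
      {within [set p : R * 'rV[R]_n | 0 <= p.1], continuous u},
      (exists M : R, forall p : R * 'rV[R]_n, 0 <= p.1 -> `|u p| <= M),
      (forall (t : R) (x : 'rV[R]_n), 0 < t ->
         8^-1 * laplacian_x (laplacian_x u) (t, x) - deriv_t u (t, x)
         = - (2^-1 * ((Num.sqrt (2 * pi * t))^-1 * laplacian f x))) &
      (forall x : 'rV[R]_n, u (0, x) = f x)].
Proof.
move=> _ model Cf u.
have mG := measurable_BM1 model.
have lawG := BM1_law model.
have indG := BM1_indep model.
have uE p : 0 <= p.1 -> u p = mixture P (BM1 Xp) 0 f p by exact: ibm_uE.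
(* From here on [u] is known only through its agreement with a mixture at nonnegative times. *)
clearbody u.
have [M fM] := Cb_infty_bounded Cf.
split.
- apply: (mixture_span_smooth mG lawG indG (mixture_span_base P (BM1 Xp) 0 0 Cf)).
  by move=> p p0; rewrite expr0 mul1r uE// ltW.
- apply: (subspace_eq_continuous (f := mixture P (BM1 Xp) 0 f)).
    by move=> p; rewrite inE => /uE E; symmetry; exact: E.
  by apply: continuous_subspaceT; exact: (continuous_mixture mG).
- have [C HC] := mixture_le_cst P mG Cf fM.
  by exists C => p p0; rewrite uE.
- move=> t x t0; apply: (mixture_pde mG lawG indG (p := (t, x)) Cf) => //.
  by move=> q q0; rewrite uE// ltW.
- by move=> x; rewrite uE// mixture0E.
Qed.
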